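(* There is a spanning subgraph $H$ of an enlarged square grid, namely a graph $H$ with $V(H)=\frac32\mathbb{Z}^2$ and $E(H)\subset\left\{\{x,y\}\in\binom{V(H)}{2} : d(x,y)=3/2\right\}$, such that for any two vertices $p$ and $q$ of $H$, $$d(p,q)-O(1)\le d_H(p,q)=d(p,q)+o\left(d(p,q)^{5/6}\right).$$ That is, there is a constant $K$ with $d_H(p,q)\ge d(p,q)-K$ for all $p,q\in V(H)$, and for every $\eta>0$ there is $D$ such that $|d_H(p,q)-d(p,q)|\le \eta\, d(p,q)^{5/6}$ for all $p,q\in V(H)$ with $d(p,q)\ge D$.
   Context: $d(p,q)$ is the Euclidean distance. $H$ is simple and unweighted; $d_H(p,q)$ is the graph distance, i.e. the minimum number of edges along a path connecting $p$ and $q$ in $H$. $\frac32\mathbb{Z}^2=\{(\frac32 x,\frac32 y): x,y\in\mathbb{Z}\}$. *)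

(* Defs.v *)
From HB Require Import structures.
From mathcomp Require Import all_boot all_order all_algebra.
From mathcomp Require Import all_classical all_reals all_analysis.

Set Implicit Arguments.
Unset Strict Implicit.
Unset Printing Implicit Defensive.

Import Order.TTheory GRing.Theory Num.Theory.

Local Open Scope classical_set_scope.
Local Open Scope ring_scope.

(* A simple graph, possibly infinite, whose vertices are points of T. *)
Record sgraph (T : eqType) := SGraph {
  vertices : set T;
  adj : rel T;
  adj_sym : symmetric adj;
  adj_irr : irreflexive adj;
  adj_vertices : forall x y, adj x y -> vertices x /\ vertices y
}.

(* p :: s is a path from p to q; it has size s edges. *)
Definition is_gpath (T : eqType) (H : sgraph T) (p q : T) (s : seq T) : Prop :=
  [/\ path (adj H) p s, last p s = q & uniq (p :: s)].

(* The infimum is over a set of natural numbers, so it is a minimum as soon as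
   some path joins p to q, and it is +oo otherwise. *)
Definition gdist (R : realType) (T : eqType) (H : sgraph T) (p q : T) : \bar R :=
  ereal_inf [set ((size s)%:R)%:E | s in is_gpath H p q].

(* The library norm on R * R is the sup norm, hence the explicit formula. *)
Definition eucl_dist (R : realType) (p q : R * R) : R :=
  Num.sqrt ((p.1 - q.1) ^+ 2 + (p.2 - q.2) ^+ 2).

Definition grid (R : realType) : set (R * R) :=
  [set p | exists x y : int, p = (3 / 2 * x%:~R, 3 / 2 * y%:~R)].
Arguments grid : clear implicits.

(* Main.v *)
Require Import Defs.
From HB Require Import structures.
From mathcomp Require Import all_boot all_order all_algebra.
From mathcomp Require Import all_classical all_reals all_analysis.
From mathcomp Require Import zify ring lra.

Set Implicit Arguments.
Unset Strict Implicit.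
Unset Printing Implicit Defensive.

Import Order.TTheory GRing.Theory Num.Theory.

Local Open Scope classical_set_scope.
Local Open Scope ring_scope.

(* Choose [F : Z^2 -> R^2] within bounded distance of [z |-> 60 z] and join the
   images of neighbouring [z] inside the grid by combs whose number of edges is
   the least admissible integer above the distance of their [F]-values. Keeping
   exactly the grid edges across which the interpolation of [F] moves by at most
   one makes the graph distance at least the Euclidean one, up to a constant.
   The problem is thus to choose [F] so that many paths lose nothing. Roads do
   this: along a staircase approximating a line, [F] takes values on this line
   at distances that are lengths of combs. At level [k] there are about
   [M = 2 ^ (40 k)] directions and parallel roads are [N = 2 ^ (360 k)] apart.
   Where roads compete, at most one is active. A trip of length [d] uses roads of
   one level in two consecutive directions, which costs [O (d / M ^ 2)]; it
   needs [O (N)] to reach the roads, and [O (1)] per inactive vertex. *)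

(** * Euclidean norm *)

(** The side [3/2] provides [3/2 >= sqrt 2]: a monotone staircase along a line has, up to rounding,
    at most as many edges as its Euclidean length, so a path is never to be shortened, only
    lengthened by teeth. Rounding comb lengths to [40 + 20 * h] does not accumulate, since the
    partial sums follow a linear function. The main obstacle is the vertices lost to other roads.
    Higher levels, being sparser, have priority; but a road of much higher level may run almost
    parallel to the one in use during a whole trip. Hence a road gives way within a radius [P]
    growing with its level, not just at crossings: in a region of the size of a trip, the active
    points of all much higher levels lie on one road, which spoils at most one of two adjacent
    parallel roads. The exponent stems from the cutoff [c] between similar and much higher levels.
    For trips of length [d], error [d ^ e] and [M = d ^ ((1 - e) / 2)], one wants [P >= d ^ (1 / c)]
    and [P * d ^ (c * (1 - e)) <= d ^ e], so [e >= (1 + c ^ 2) / (c + c ^ 2)]. The minimum,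
    [2 * sqrt 2 - 2 < 5 / 6], is at [c = 1 + sqrt 2], close to the [5 / 2] used here. *)

Section Euclid.
Variable R : rcfType.
Implicit Types x y a b c d k : R.

Definition enorm x y : R := Num.sqrt (x ^+ 2 + y ^+ 2).

Lemma enorm_ge0 x y : 0 <= enorm x y.
Proof. exact: sqrtr_ge0. Qed.

Lemma sqr_enorm x y : enorm x y ^+ 2 = x ^+ 2 + y ^+ 2.
Proof. by rewrite sqr_sqrtr // addr_ge0 ?sqr_ge0. Qed.

Lemma enorm_le x y c : 0 <= c -> x ^+ 2 + y ^+ 2 <= c ^+ 2 -> enorm x y <= c.
Proof.
move=> c0 h; rewrite -(@ler_pXn2r _ 2%N) ?nnegrE ?enorm_ge0 //.
by rewrite sqr_enorm.
Qed.

Lemma enormN x y : enorm (- x) (- y) = enorm x y.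
Proof. by rewrite /enorm !sqrrN. Qed.

Lemma enormD a b c d : enorm (a + c) (b + d) <= enorm a b + enorm c d.
Proof.
apply: enorm_le; first by rewrite addr_ge0 ?enorm_ge0.
rewrite (sqrrD (enorm a b)) !sqr_enorm.
suff : a * c + b * d <= enorm a b * enorm c d by nra.
apply: le_trans (ler_norm _) _.
rewrite -(@ler_pXn2r _ 2%N) ?nnegrE ?mulr_ge0 ?enorm_ge0 //.
rewrite exprMn !sqr_enorm real_normK ?num_real //.
have := sqr_ge0 (a * d - b * c); nra.
Qed.

Lemma enormZ k x y : enorm (k * x) (k * y) = `|k| * enorm x y.
Proof.
by rewrite /enorm !exprMn -mulrDr sqrtrM ?sqr_ge0 // sqrtr_sqr.
Qed.

Lemma enorm_le_l1 x y : enorm x y <= `|x| + `|y|.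
Proof.
apply: enorm_le; first by rewrite addr_ge0.
rewrite -(real_normK (num_real x)) -(real_normK (num_real y)).
have := normr_ge0 x; have := normr_ge0 y; nra.
Qed.

Lemma normr_le_enorm x y : `|x| <= enorm x y.
Proof. by rewrite -sqrtr_sqr ler_wsqrtr // lerDl sqr_ge0. Qed.

Lemma enormC x y : enorm x y = enorm y x.
Proof. by rewrite /enorm addrC. Qed.

Lemma l1_le_enorm x y : `|x| + `|y| <= 2 * enorm x y.
Proof.
have := normr_le_enorm x y; have := normr_le_enorm y x.
by rewrite (enormC y x); lra.
Qed.

(* The defect [2 (|a| |b| - a.b) / (|a| + |b| + |a + b|)] of the triangle
   inequality is small because [|a| |b| - a.b = det^2 / (|a| |b| + a.b)]. *)
Lemma enorm_cone u1 u2 v1 v2 al be (delta : R) :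
  0 <= al -> 0 <= be -> 1 <= 2 * enorm u1 u2 -> 1 <= 2 * enorm v1 v2 ->
  0 <= u1 * v1 + u2 * v2 -> `|u1 * v2 - u2 * v1| <= delta ->
  al * enorm u1 u2 + be * enorm v1 v2
    <= enorm (al * u1 + be * v1) (al * u2 + be * v2)
       + 4 * (al + be) * delta ^+ 2.
Proof.
move=> al0 be0 u1h v1h dot0 det_le.
set U := enorm u1 u2; set V := enorm v1 v2.
set W := enorm (_ + _) _.
have W0 : 0 <= W := enorm_ge0 _ _.
have W2 : W ^+ 2 = (al * u1 + be * v1) ^+ 2 + (al * u2 + be * v2) ^+ 2.
  exact: sqr_enorm.
have U2 : U ^+ 2 = u1 ^+ 2 + u2 ^+ 2 := sqr_enorm _ _.
have V2 : V ^+ 2 = v1 ^+ 2 + v2 ^+ 2 := sqr_enorm _ _.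
have Uh : 1 <= 2 * U by []. have Vh : 1 <= 2 * V by [].
have D2 : (u1 * v2 - u2 * v1) ^+ 2 <= delta ^+ 2.
  rewrite -(real_normK (num_real (u1 * _ - _))).
  by rewrite ler_pXn2r ?nnegrE // (le_trans _ det_le).
set dot := u1 * v1 + u2 * v2 in dot0 *.
have UVdot : U ^+ 2 * V ^+ 2 - dot ^+ 2 = (u1 * v2 - u2 * v1) ^+ 2.
  by rewrite U2 V2 /dot; ring.
have gap : U * V - dot <= 4 * delta ^+ 2.
  have UV4 : 1 <= 4 * (U * V) by nra.
  have e : (U * V - dot) * (U * V + dot) <= delta ^+ 2.
    by rewrite -subr_sqr exprMn UVdot.
  have d0 : 0 <= delta ^+ 2 by exact: sqr_ge0.
  have [h|h] := lerP (U * V - dot) 0; first by lra.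
  nra.
have gap2 : al * be * (U * V - dot) <= al * be * (4 * delta ^+ 2).
  by apply: ler_wpM2l => //; rewrite mulr_ge0.
have W2' : W ^+ 2 = (al * U + be * V) ^+ 2 - 2 * (al * be * (U * V - dot)).
  by rewrite W2 /dot; ring: U2 V2.
set S := al * U + be * V in W2' *.
have S0 : al + be <= 2 * S by rewrite /S; nra.
have d0 : 0 <= delta ^+ 2 by exact: sqr_ge0.
have [h|h] := lerP S W; first by nra.
have step : (S - W) * S <= 8 * (al * be * delta ^+ 2).
  have -> : 8 * (al * be * delta ^+ 2) = 2 * (al * be * (4 * delta ^+ 2)) by ring.
  apply: le_trans (_ : (S - W) * (S + W) <= _).
    by apply: ler_wpM2l; lra.
  by rewrite -subr_sqr W2'; lra.
have ab : 4 * (al * be) <= (al + be) ^+ 2.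
  by have := sqr_ge0 (al - be); nra.
have s2 : (S - W) * S <= 4 * (al + be) * delta ^+ 2 * S.
  apply: le_trans step _.
  apply: le_trans (_ : 2 * (al + be) ^+ 2 * delta ^+ 2 <= _).
    by have := ler_wpM2r d0 ab; lra.
  have := ler_wpM2r d0 (ler_wpM2l (addr_ge0 al0 be0) S0); lra.
have S_gt0 : 0 < S by lra.
by move: s2; rewrite ler_pM2r //; lra.
Qed.

End Euclid.

(** * Walks and combs *)

Lemma eucl_distE (R : realType) (p q : R * R) :
  eucl_dist p q = enorm (p.1 - q.1) (p.2 - q.2).
Proof. by []. Qed.

Lemma eucl_dist_triangle (R : realType) (p q r : R * R) :
  eucl_dist p r <= eucl_dist p q + eucl_dist q r.
Proof.
rewrite !eucl_distE.
have -> : p.1 - r.1 = p.1 - q.1 + (q.1 - r.1) by ring.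
have -> : p.2 - r.2 = p.2 - q.2 + (q.2 - r.2) by ring.
exact: enormD.
Qed.

Lemma eucl_distC (R : realType) (p q : R * R) : eucl_dist p q = eucl_dist q p.
Proof. by rewrite !eucl_distE -enormN !opprB. Qed.

Lemma eucl_distxx (R : realType) (p : R * R) : eucl_dist p p = 0.
Proof. by rewrite eucl_distE !subrr /enorm expr0n addr0 sqrtr0. Qed.

Section Walk.
Variables (R : realType) (T : eqType) (e : rel T).

(** Walks may repeat vertices and the bound is real, so that costs just add up along a trip;
    repetitions are removed in [comb_graph_upper]. *)
Definition reach (p q : T) (c : R) : Prop :=
  exists s : seq T, [/\ path e p s, last p s = q & (size s)%:R <= c].

Lemma reach_refl p c : 0 <= c -> reach p p c.
Proof. by exists [::]. Qed.

Lemma reach_le p q c c' : c <= c' -> reach p q c -> reach p q c'.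
Proof. by move=> h [s [? ? sc]]; exists s; split => //; exact: le_trans h. Qed.

Lemma reach_trans q p r c c' :
  reach p q c -> reach q r c' -> reach p r (c + c').
Proof.
move=> [s [ps <- sc]] [s' [ps' <- sc']]; exists (s ++ s').
by rewrite cat_path ps ps' last_cat size_cat natrD lerD.
Qed.

Lemma reach_edge p q : e p q -> reach p q 1.
Proof. by move=> h; exists [:: q]; rewrite /= h. Qed.

Lemma reach_sym p q c : symmetric e -> reach p q c -> reach q p c.
Proof.
move=> esym [s [ps <- sc]]; exists (rev (belast p s)); split.
- rewrite rev_path; apply: sub_path ps => x y; by rewrite esym.
- by case: s {ps sc} => //= x s; rewrite rev_cons last_rcons.
- by rewrite size_rev size_belast.
Qed.

End Walk.

(* Arc length along the comb-shaped path that leaves [(0, 0)], follows row 0 up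
   to column 20, and then runs up and down the columns 20, ..., 39 up to
   height [h]; the vertices above height [h] are hung on the top of their
   column. *)
Definition comb_pos (h x y : nat) : nat :=
  if (x < 20)%N then x else
  (20 + h.+1 * (x - 20)
   + (if odd (x - 20) then h - minn y h else minn y h))%N.

Lemma comb_pos_le h x y : (x < 40)%N -> (comb_pos h x y <= 40 + 20 * h)%N.
Proof.
move=> x40; rewrite /comb_pos; case: ltnP => x20; first by lia.
have : (x - 20 <= 19)%N by lia.
move: (x - 20)%N => i i19.
have : (h.+1 * i <= h.+1 * 19)%N by rewrite leq_mul2l i19 orbT.
by case: odd; lia.
Qed.

Lemma comb_pos_column h x y :
  (comb_pos h x y <= (comb_pos h x y.+1).+1)%N &&
  (comb_pos h x y.+1 <= (comb_pos h x y).+1)%N.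
Proof.
rewrite /comb_pos; case: ltnP => x20; first by rewrite !leqnSn.
by move: (h.+1 * _)%N => p; case: odd; lia.
Qed.

Definition nbr (d : bool) (z : int * int) : int * int :=
  if d then (z.1, z.2 + 1) else (z.1 + 1, z.2).

Section Comb.
Variable R : realType.
Variable F : int * int -> R * R.
Hypothesis F_close :
  forall z, enorm ((F z).1 - 60 * z.1%:~R) ((F z).2 - 60 * z.2%:~R) <= 105.

Lemma F_nbr d z : eucl_dist (F z) (F (nbr d z)) <= 270.
Proof.
pose G (w : int * int) : R * R := (60 * w.1%:~R, 60 * w.2%:~R).
have h1 : eucl_dist (F z) (G z) <= 105 := F_close z.
have h2 : eucl_dist (G (nbr d z)) (F (nbr d z)) <= 105.
  by rewrite eucl_distC; exact: F_close.
have h3 : eucl_dist (G z) (G (nbr d z)) <= 60.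
  rewrite eucl_distE; apply: enorm_le => //.
  by case: d {h2}; rewrite /G /= intrD; nra.
have h4 := eucl_dist_triangle (F z) (G z) (F (nbr d z)).
have h5 := eucl_dist_triangle (G z) (G (nbr d z)) (F (nbr d z)).
by lra.
Qed.

Lemma exists_teeth d z :
  exists h : nat, eucl_dist (F z) (F (nbr d z)) <= (40 + 20 * h)%:R.
Proof.
by exists 12%N; apply: le_trans (F_nbr d z) _; rewrite ler_nat.
Qed.

Definition teeth (d : bool) (z : int * int) : nat := ex_minn (exists_teeth d z).

(** 20 edges along row 0, then [h] vertical edges and one horizontal edge for each of the 20
    columns. *)
Definition comb_len d z : nat := (40 + 20 * teeth d z)%N.

Lemma comb_len_ge d z : eucl_dist (F z) (F (nbr d z)) <= (comb_len d z)%:R.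
Proof. by rewrite /comb_len /teeth; case: ex_minnP. Qed.

Lemma comb_len_min d z (h : nat) :
  eucl_dist (F z) (F (nbr d z)) <= (40 + 20 * h)%:R ->
  (comb_len d z <= 40 + 20 * h)%N.
Proof.
rewrite /comb_len /teeth; case: ex_minnP => m _ hm /hm; lia.
Qed.

(** As 12 < 20, teeth on the columns from 20 on stay below the diagonal of the cell, away from the
    comb in the other direction. *)
Lemma teeth_le d z : (teeth d z <= 12)%N.
Proof.
have : (comb_len d z <= 40 + 20 * 12)%N; last by rewrite /comb_len; lia.
by apply: comb_len_min; apply: le_trans (F_nbr d z) _; rewrite ler_nat.
Qed.

Lemma comb_len_gt0 d z : 0 < (comb_len d z)%:R :> R.
Proof. by rewrite ltr0n. Qed.

Definition interp d z (t : nat) : R * R :=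
  ((F z).1 + t%:R / (comb_len d z)%:R * ((F (nbr d z)).1 - (F z).1),
   (F z).2 + t%:R / (comb_len d z)%:R * ((F (nbr d z)).2 - (F z).2)).

Lemma interp0 d z : interp d z 0 = F z.
Proof. by rewrite /interp !mul0r !addr0; case: (F z). Qed.

Lemma interp_end d z : interp d z (comb_len d z) = F (nbr d z).
Proof.
rewrite /interp divff ?gt_eqF ?comb_len_gt0 // !mul1r.
by case: (F (nbr d z)) => a b /=; congr pair; ring.
Qed.

(** The speed is at most one because the comb is at least as long as the segment onto which it is
    mapped. Hence all edges of combs survive in the graph. *)
Lemma interp_step d z (t t' : nat) : (t <= t'.+1)%N -> (t' <= t.+1)%N ->
  eucl_dist (interp d z t) (interp d z t') <= 1.
Proof.
move=> tt' t't; set w : R := (comb_len d z)%:R.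
have w0 : 0 < w := comb_len_gt0 d z.
have -> : eucl_dist (interp d z t) (interp d z t')
   = `|(t'%:R - t%:R) / w| * eucl_dist (F z) (F (nbr d z)).
  rewrite !eucl_distE -enormZ /interp /= -/w.
  by congr enorm; field; rewrite gt_eqF.
rewrite normrM normfV (gtr0_norm w0).
have dt : `|t'%:R - t%:R| <= 1 :> R.
  rewrite ler_norml; move: tt' t't; rewrite -!(ler_nat R) -!natr1; lra.
have FF : eucl_dist (F z) (F (nbr d z)) <= w := comb_len_ge d z.
have F0 : 0 <= eucl_dist (F z) (F (nbr d z)) := enorm_ge0 _ _.
rewrite mulrAC ler_pdivrMr // mul1r.
by apply: le_trans FF; rewrite ler_piMl.
Qed.

(** Each 40 by 40 cell is cut along its diagonal between the comb going right and the transposed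
    comb going up. Vertices off the combs also need a value, as edges are selected among all grid
    edges. *)
Definition drawing (P : int * int) : R * R :=
  let z := ((P.1 %/ 40)%Z, (P.2 %/ 40)%Z) in
  let x := `|(P.1 %% 40)%Z|%N in
  let y := `|(P.2 %% 40)%Z|%N in
  if (y <= x)%N then interp false z (comb_pos (teeth false z) x y)
  else interp true z (comb_pos (teeth true z) y x).

Definition fine_edge : rel (int * int) := fun P Q =>
  (`|P.1 - Q.1| + `|P.2 - Q.2| == 1) &&
  (eucl_dist (drawing P) (drawing Q) <= 1).

Lemma fine_edge_sym : symmetric fine_edge.
Proof.
by move=> P Q; rewrite /fine_edge eucl_distC (distrC P.1) (distrC P.2).
Qed.

Definition fine (d : bool) (z : int * int) (x y : nat) : int * int :=
  if d then (40 * z.1 + y%:Z, 40 * z.2 + x%:Z)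
  else (40 * z.1 + x%:Z, 40 * z.2 + y%:Z).

(** The diagonal belongs to the horizontal comb, but the corner counts for both: either
    interpolation has the value [F z] there. *)
Definition in_comb (d : bool) (x y : nat) : bool :=
  (x < 40)%N && ((y < x + ~~ d)%N || (x == 0%N) && (y == 0%N)).

Lemma drawing_fine d z x y : in_comb d x y ->
  drawing (fine d z x y) = interp d z (comb_pos (teeth d z) x y).
Proof.
have D (a : int) (b : nat) : (b < 40)%N -> ((40 * a + b%:Z) %/ 40)%Z = a.
  by move=> b40; lia.
have M (a : int) (b : nat) : (b < 40)%N -> `|((40 * a + b%:Z) %% 40)%Z|%N = b.
  by move=> b40; lia.
case: z => z1 z2; case: d; rewrite /in_comb /drawing /fine /=.
- rewrite addn0 => /andP[x40 /orP[yx|/andP[/eqP-> /eqP->]]].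
    by rewrite !D ?M //; [rewrite leqNgt yx | lia..].
  by rewrite !D ?M //= /comb_pos /= !interp0.
- rewrite addn1 ltnS => /andP[x40 h].
  have yx : (y <= x)%N by case/orP: h => // /andP[/eqP-> /eqP->].
  by rewrite !D ?M ?yx //; lia.
Qed.

Definition coarse (z : int * int) : int * int := (40 * z.1, 40 * z.2).

Lemma fine00 d z : fine d z 0 0 = coarse z.
Proof. by case: d; rewrite /fine /coarse !addr0. Qed.

Lemma fine_end d z : fine d z 40 0 = coarse (nbr d z).
Proof. by case: d; rewrite /fine /coarse /nbr /= addr0 mulrDr mulr1. Qed.

Lemma drawing_coarse z : drawing (coarse z) = F z.
Proof. by rewrite -(fine00 false) drawing_fine //= /comb_pos /= interp0. Qed.

Lemma fine_dist d z x y x' y' :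
  `|(fine d z x y).1 - (fine d z x' y').1|
  + `|(fine d z x y).2 - (fine d z x' y').2|
  = `|x%:Z - x'%:Z| + `|y%:Z - y'%:Z|.
Proof. by case: d; rewrite /fine /=; lia. Qed.

Lemma fine_edgeP d z x y x' y' :
  in_comb d x y -> in_comb d x' y' ->
  `|x%:Z - x'%:Z| + `|y%:Z - y'%:Z| = 1 ->
  (comb_pos (teeth d z) x y <= (comb_pos (teeth d z) x' y').+1)%N ->
  (comb_pos (teeth d z) x' y' <= (comb_pos (teeth d z) x y).+1)%N ->
  fine_edge (fine d z x y) (fine d z x' y').
Proof.
move=> i1 i2 dist1 t1 t2; rewrite /fine_edge fine_dist dist1 eqxx /=.
by rewrite !drawing_fine //; exact: interp_step.
Qed.

Notation freach := (reach (R := R) fine_edge).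

Lemma in_comb_le d x y y' : (y' <= y)%N -> in_comb d x y -> in_comb d x y'.
Proof. by rewrite /in_comb; case: d; lia. Qed.

Lemma reach_column d z x y n : in_comb d x (y + n) ->
  freach (fine d z x y) (fine d z x (y + n)) n%:R.
Proof.
elim: n => [|n IHn] h; first by rewrite addn0; exact: reach_refl.
have h' : in_comb d x (y + n) by apply: in_comb_le h; lia.
rewrite -natr1; apply: reach_trans (IHn h') _; apply: reach_edge.
have := comb_pos_column (teeth d z) x (y + n).
rewrite -addnS => /andP[t1 t2].
by apply: fine_edgeP => //; lia.
Qed.

(** Columns from 20 on are run alternately up and down, starting upwards; as there are 20 of them,
    the last is left in row 0, next to the following coarse point. *)
Definition comb_entry (h x : nat) : nat := if (20 < x)%N && odd (x - 20) then h else 0.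
Definition comb_exit (h x : nat) : nat :=
  if (20 <= x)%N && ~~ odd (x - 20) then h else 0.

Lemma in_comb_low d x y : (x < 40)%N -> (y <= 12)%N -> (x < 20)%N ==> (y == 0%N) ->
  in_comb d x y.
Proof. by rewrite /in_comb; case: d; lia. Qed.

Lemma entry_in d z x : (x < 40)%N -> in_comb d x (comb_entry (teeth d z) x).
Proof.
move=> x40; apply: in_comb_low => //; rewrite /comb_entry; have := teeth_le d z;
  case: ifP; lia.
Qed.

Lemma exit_in d z x : (x < 40)%N -> in_comb d x (comb_exit (teeth d z) x).
Proof.
move=> x40; apply: in_comb_low => //; rewrite /comb_exit; have := teeth_le d z;
  case: ifP; lia.
Qed.

Lemma reach_exit d z x : (x < 40)%N ->
  freach (fine d z x (comb_entry (teeth d z) x)) (fine d z x (comb_exit (teeth d z) x))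
    (if (20 <= x)%N then teeth d z else 0%N)%:R.
Proof.
move=> x40; have i1 := entry_in d z x40; have i2 := exit_in d z x40.
move: i1 i2; rewrite /comb_entry /comb_exit; case: (ltngtP x 20) => hx /=.
- by move=> _ _; apply: reach_refl.
- case: odd => /= i1 i2.
    by apply: reach_sym; [exact: fine_edge_sym | exact: (@reach_column _ _ _ 0)].
  exact: (@reach_column _ _ _ 0).
- by rewrite hx /= => _ i2; exact: (@reach_column _ _ _ 0).
Qed.

Lemma comb_pos_entry h x : comb_pos h x (comb_entry h x) =
  if (x < 20)%N then x else (20 + h.+1 * (x - 20))%N.
Proof.
rewrite /comb_pos /comb_entry; case: (ltngtP x 20) => hx //=.
  by case: odd => /=; lia.
by rewrite hx /=; lia.
Qed.

Lemma comb_pos_exit h x : comb_pos h x (comb_exit h x) =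
  if (x < 20)%N then x else (20 + h.+1 * (x - 20) + h)%N.
Proof.
rewrite /comb_pos /comb_exit; case: (ltnP x 20) => hx //=.
by case: odd => /=; lia.
Qed.

Lemma comb_pos_entryS h x :
  comb_pos h x.+1 (comb_entry h x.+1) = (comb_pos h x (comb_exit h x)).+1.
Proof.
rewrite comb_pos_entry comb_pos_exit; case: (ltngtP x 19) => hx.
- have -> : (x.+1 < 20)%N by lia.
  by have -> : (x < 20)%N by lia.
- have -> : (x.+1 < 20)%N = false by lia.
  have -> : (x < 20)%N = false by lia.
  by rewrite subSn ?mulnS //; lia.
- by rewrite hx /= muln0.
Qed.

Lemma exit_entryS h x : (x < 39)%N -> comb_exit h x = comb_entry h x.+1.
Proof.
move=> x39; rewrite /comb_exit /comb_entry; case: (leqP 20 x) => hx /=.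
  by rewrite ltnS hx subSn //=.
by have -> : (20 < x.+1)%N = false by lia.
Qed.

Lemma reach_entry d z x : (x < 40)%N ->
  freach (coarse z) (fine d z x (comb_entry (teeth d z) x))
    (comb_pos (teeth d z) x (comb_entry (teeth d z) x))%:R.
Proof.
elim: x => [|x IHx] x40.
  by rewrite /= fine00; apply: reach_refl.
have x40' : (x < 40)%N by lia.
have st : freach (fine d z x (comb_exit (teeth d z) x))
               (fine d z x.+1 (comb_entry (teeth d z) x.+1)) 1.
  apply: reach_edge; apply: fine_edgeP.
  - exact: exit_in.
  - exact: entry_in.
  - by rewrite exit_entryS; lia.
  - by rewrite comb_pos_entryS; lia.
  - by rewrite comb_pos_entryS.
apply: reach_le (reach_trans (IHx x40') (reach_trans (reach_exit d z x40') st)).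
rewrite natr1 -natrD ler_nat comb_pos_entryS.
by rewrite comb_pos_entry comb_pos_exit; case: ltnP => h1; lia.
Qed.

Lemma reach_nbr d z : freach (coarse z) (coarse (nbr d z)) (comb_len d z)%:R.
Proof.
have e39 : comb_exit (teeth d z) 39 = 0%N by [].
have st : freach (fine d z 39 0) (coarse (nbr d z)) 1.
  (* This edge ends in the next cell, where the drawing is [F (nbr d z)], the value of [interp] at
     time [comb_len d z]. *)
  apply: reach_edge; rewrite /fine_edge -fine_end fine_dist /= -e39.
  rewrite drawing_fine ?exit_in // fine_end drawing_coarse -interp_end.
  apply: interp_step; rewrite comb_pos_exit /comb_len /=; lia.
have h := reach_trans (reach_entry d z (isT : (39 < 40)%N))
   (reach_trans (reach_exit d z (isT : (39 < 40)%N)) _).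
rewrite e39 in h; apply: reach_le (h _ _ st).
rewrite natr1 -natrD ler_nat comb_pos_entry /comb_len /=; lia.
Qed.

Lemma reach_nbr_le d z (h : nat) :
  eucl_dist (F z) (F (nbr d z)) <= (40 + 20 * h)%:R ->
  freach (coarse z) (coarse (nbr d z)) (40 + 20 * h)%:R.
Proof.
move=> /comb_len_min h'; apply: reach_le (reach_nbr d z); by rewrite ler_nat.
Qed.

Lemma reach_nbr280 d z : freach (coarse z) (coarse (nbr d z)) 280.
Proof.
apply: (@reach_nbr_le d z 12); apply: le_trans (F_nbr d z) _.
by rewrite ler_nat.
Qed.

Lemma fine_surj (P : int * int) : exists d z x y, P = fine d z x y /\ in_comb d x y.
Proof.
pose z : int * int := ((P.1 %/ 40)%Z, (P.2 %/ 40)%Z).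
pose x := `|(P.1 %% 40)%Z|%N; pose y := `|(P.2 %% 40)%Z|%N.
case: P @z @x @y => P1 P2 z x y.
case: (leqP y x) => h.
- exists false, z, x, y; rewrite /in_comb /fine /x /y /=; split.
    by congr pair; lia.
  by move: h; rewrite /x /y /=; lia.
- exists true, z, y, x; rewrite /in_comb /fine /x /y /=; split.
    by congr pair; lia.
  by move: h; rewrite /x /y /=; lia.
Qed.

(** By [comb_pos_column] no edge along a column of a comb is dropped. So a vertex can go to row 0,
    then to where the comb enters its column, and back along the comb: at most 39 + 12 + 280
    edges. *)
Lemma reach_coarse (P : int * int) : exists z : int * int,
  [/\ freach P (coarse z) 400, `|P.1 - 40 * z.1| <= 40 & `|P.2 - 40 * z.2| <= 40].
Proof.
have [d [z [x [y [-> i1]]]]] := fine_surj P; exists z.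
have x40 : (x < 40)%N by case/andP: i1.
have y40 : (y < 40)%N by move: i1; rewrite /in_comb; case: (d); lia.
split; last 2 first.
- by case: d {i1}; rewrite /fine /=; lia.
- by case: d {i1}; rewrite /fine /=; lia.
have R1 := reach_entry d z x40.
have i2 := entry_in d z x40.
have i0 : in_comb d x 0 by apply: in_comb_le i1.
have R2 := @reach_column d z x 0 y i1.
have R3 := @reach_column d z x 0 _ i2.
have R4 := reach_trans (reach_sym fine_edge_sym R2)
   (reach_trans R3 (reach_sym fine_edge_sym R1)).
apply: reach_le R4; rewrite -!natrD ler_nat.
have e12 : (comb_entry (teeth d z) x <= 12)%N.
  by have := teeth_le d z; rewrite /comb_entry; case: ifP; lia.
have := comb_pos_le (teeth d z) (comb_entry (teeth d z) x) x40.
by have := teeth_le d z; lia.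
Qed.

Lemma drawing_close (P : int * int) :
  eucl_dist (drawing P) (3 / 2 * P.1%:~R, 3 / 2 * P.2%:~R) <= 500.
Proof.
have [d [z [x [y [-> i1]]]]] := fine_surj P.
have x40 : (x < 40)%N by case/andP: i1.
have y40 : (y < 40)%N by move: i1; rewrite /in_comb; case: (d); lia.
rewrite drawing_fine //; set t := comb_pos _ _ _.
pose G (w : int * int) : R * R := (60 * w.1%:~R, 60 * w.2%:~R).
have h1 : eucl_dist (F z) (G z) <= 105 := F_close z.
have h2 : eucl_dist (interp d z t) (F z) <= 270.
  rewrite eucl_distE /interp /= ![(F z).1 + _]addrC ![(F z).2 + _]addrC !addrK.
  rewrite enormZ.
  have w0 := comb_len_gt0 d z.
  have t0 : 0 <= t%:R / (comb_len d z)%:R :> R by rewrite divr_ge0.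
  have t1 : t%:R / (comb_len d z)%:R <= 1 :> R.
    by rewrite ler_pdivrMr // mul1r ler_nat; exact: comb_pos_le.
  rewrite ger0_norm // -[enorm _ _]/(eucl_dist (F (nbr d z)) (F z)) eucl_distC.
  by apply: le_trans (F_nbr d z); rewrite ler_piMl ?enorm_ge0.
set Q : R * R := (_, _).
have h3 : eucl_dist (G z) Q <= 120.
  rewrite eucl_distE; apply: le_trans (enorm_le_l1 _ _) _.
  have xR : x%:R <= 40 :> R by rewrite (ler_nat R x 40) ltnW.
  have yR : y%:R <= 40 :> R by rewrite (ler_nat R y 40) ltnW.
  have x0 : 0 <= x%:R :> R by [].
  have y0 : 0 <= y%:R :> R by [].
  have H (a : int) (b : R) : 0 <= b -> b <= 40 ->
      `|60 * a%:~R - 3 / 2 * (40 * a%:~R + b)| <= 60.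
    by move=> ? ?; rewrite ler_norml; lra.
  by rewrite /G /Q; case: (d) => /=; rewrite !intrD !intrM /= -!pmulrn;
    have := H z.1 _ x0 xR; have := H z.2 _ x0 xR; have := H z.1 _ y0 yR;
    have := H z.2 _ y0 yR; lra.
have h4 := eucl_dist_triangle (interp d z t) (F z) Q.
have h5 := eucl_dist_triangle (F z) (G z) Q.
by lra.
Qed.

End Comb.

(** * The comb graph *)

Section CombGraph.
Variable R : realType.
Variable F : int * int -> R * R.
Hypothesis F_close :
  forall z, enorm ((F z).1 - 60 * z.1%:~R) ((F z).2 - 60 * z.2%:~R) <= 105.

Definition grid_pt (P : int * int) : R * R := (3 / 2 * P.1%:~R, 3 / 2 * P.2%:~R).

Definition grid_index (p : R * R) : int * int :=
  (Num.floor (p.1 * (2 / 3)), Num.floor (p.2 * (2 / 3))).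

Lemma grid_ptK : cancel grid_pt grid_index.
Proof.
have E (a : int) : 3 / 2 * a%:~R * (2 / 3) = a%:~R :> R by field.
by case=> a b; rewrite /grid_pt /grid_index /= !E !intrKfloor.
Qed.

Lemma gridP (p : R * R) : grid R p <-> p = grid_pt (grid_index p).
Proof.
split=> [[x [y ->]]|->].
  by have := grid_ptK (x, y); rewrite {1}/grid_pt /= => ->.
by exists (grid_index p).1, (grid_index p).2.
Qed.

Let edge := fine_edge F_close.

Definition comb_adj : rel (R * R) := fun p q =>
  [&& p == grid_pt (grid_index p), q == grid_pt (grid_index q)
    & edge (grid_index p) (grid_index q)].

Lemma comb_adj_sym : symmetric comb_adj.
Proof. by move=> p q; rewrite /comb_adj /edge fine_edge_sym andbCA. Qed.

Lemma comb_adj_irr : irreflexive comb_adj.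
Proof.
move=> p; apply/negP => /and3P[_ _ /andP[/eqP h _]]; move: h.
by move: (grid_index p) => P; lia.
Qed.

Lemma comb_adj_vertices p q : comb_adj p q -> grid R p /\ grid R q.
Proof. by case/and3P => /eqP pE /eqP qE _; split; apply/gridP. Qed.

Definition comb_graph : sgraph (R * R)%type :=
  SGraph comb_adj_sym comb_adj_irr comb_adj_vertices.

Lemma comb_graph_edge p q : adj comb_graph p q -> eucl_dist p q = 3 / 2.
Proof.
case/and3P => /eqP-> /eqP-> /andP[/eqP dist1 _].
move: dist1; rewrite !grid_ptK; set P := grid_index p; set Q := grid_index q => dist1.
rewrite eucl_distE /grid_pt /= -!mulrBr -!rmorphB /= enormZ ger0_norm //.
suff -> : enorm (P.1 - Q.1)%:~R (P.2 - Q.2)%:~R = 1 :> R by rewrite mulr1.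
rewrite /enorm -!rmorphXn -rmorphD /=.
have -> : (P.1 - Q.1) ^+ 2 + (P.2 - Q.2) ^+ 2 = 1.
  move: dist1; move: (P.1 - Q.1) (P.2 - Q.2) => /= a b h.
  have [[[->|->] ->]|[-> [->|->]]] :
    ((a = 1 \/ a = -1) /\ b = 0) \/ (a = 0 /\ (b = 1 \/ b = -1)) by lia.
  1-4: by rewrite ?sqrrN ?expr1n ?expr0n ?addr0 ?add0r.
by rewrite sqrtr1.
Qed.

Lemma comb_path_drawing p s : path comb_adj p s ->
  eucl_dist (drawing F_close (grid_index p))
    (drawing F_close (grid_index (last p s))) <= (size s)%:R.
Proof.
elim: s p => [|q s IHs] p /=; first by rewrite eucl_distxx.
case/andP => /and3P[_ _ /andP[_ pq]] /IHs; rewrite -natr1.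
have := eucl_dist_triangle (drawing F_close (grid_index p))
  (drawing F_close (grid_index q)) (drawing F_close (grid_index (last q s))).
lra.
Qed.

(** The drawing moves by at most one along each edge and displaces each of the two end points by at
    most 500. *)
Lemma comb_graph_lower p q : vertices comb_graph p -> vertices comb_graph q ->
  ((eucl_dist p q - 1000)%:E <= gdist R comb_graph p q)%E.
Proof.
move=> /gridP pE /gridP qE; apply: le_ereal_inf_tmp => _ [s [ps sq _] <-].
rewrite lee_fin; have := comb_path_drawing ps; rewrite sq.
have := drawing_close F_close (grid_index p).
have := drawing_close F_close (grid_index q).
rewrite -/(grid_pt (grid_index p)) -/(grid_pt (grid_index q)) -pE -qE.
have := eucl_dist_triangle p (drawing F_close (grid_index p)) q.
have := eucl_dist_triangle (drawing F_close (grid_index p))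
  (drawing F_close (grid_index q)) q.
rewrite (eucl_distC p (drawing _ _)); lra.
Qed.

Lemma comb_graph_upper P Q c : reach (R := R) edge P Q c ->
  (gdist R comb_graph (grid_pt P) (grid_pt Q) <= c%:E)%E.
Proof.
move=> [s [Ps sQ sc]].
have ps : path comb_adj (grid_pt P) (map grid_pt s).
  rewrite path_map; apply: sub_path Ps => x y xy.
  by rewrite /= /comb_adj !grid_ptK !eqxx.
have lq : last (grid_pt P) (map grid_pt s) = grid_pt Q by rewrite last_map sQ.
case/shortenP: ps lq => s' ps' us' ss' lq.
apply: (@le_trans _ _ ((size s')%:R)%:E).
  by apply: ereal_inf_lbound; exists s'.
rewrite lee_fin (le_trans _ sc) // ler_nat -(size_map grid_pt s).
by apply: uniq_leq_size ss'; case/andP: us'.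
Qed.

End CombGraph.

(** * Roads *)

(** The kernel of a well-founded digraph: membership of [x] depends on smaller elements only, so [A]
    may occur negatively in its own definition. For roads, smaller will mean of higher level. *)
Lemma wf_kernel (T : Type) (lt : T -> T -> Prop) (V : T -> Prop) :
  well_founded lt ->
  exists A : T -> Prop, forall x, A x <-> V x /\ forall y, lt y x -> ~ A y.
Proof.
move=> wf.
pose body x (rec : forall y, lt y x -> Prop) : Prop :=
  V x /\ forall y (h : lt y x), ~ rec y h.
exists (Fix wf (fun _ => Prop) body) => x; rewrite Fix_eq //.
move=> y f g fg; congr (_ /\ _).
by apply: eq_forall => z; apply: eq_forall => h; rewrite fg.
Qed.

(* The road [r] runs along the line [phi s = lam r] of direction
   [(1 - |s|, s)], where [s = num r / lvlM (lvl r)]. *)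
Record road := Road { lvl : nat; num : int; off : int }.

Section Roads.
Variable R : realType.
Implicit Types (r : road) (z : int * int).

(* At level [j], slopes are odd multiples of [1 / M], parallel roads are [N]
   apart, and a road gives way within distance [P] of the other roads of its
   level and of the active roads of higher levels. Level [k], with [t = 2 ^ k],
   serves the distances [d] between [t ^ 468] and [2 ^ 468 * t ^ 468]. An error
   smaller than [d ^ (5 / 6)], that is than [t ^ 390], needs
   468 / 6 < 2 * 40 (error [d / M ^ 2] from the choice of directions),
   360 < 390 (distance to the nearest road),
   188 + 2 * 40 + 468 / 6 < 360 (vertices lost to roads of similar levels), and
   188 + 2 * (5 / 2) * 40 < 390 (vertices lost to sparse roads of levels below
   [5 k / 2]); for the levels from [5 k / 2] on one needs 188 * 5 / 2 > 468. *)
Definition lvlM (j : nat) : R := 2 ^+ (40 * j).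
Definition lvlP (j : nat) : R := 2 ^+ (188 * j).
Definition lvlN (j : nat) : R := 2 ^+ (360 * j).

(** An odd numerator over a power of two determines the level, so roads of different levels are
    never parallel. *)
Definition valid r : Prop :=
  ~ (2 %| num r)%Z /\ `|num r| < 2 ^+ (40 * lvl r).

Definition slope r : R := (num r)%:~R / lvlM (lvl r).

Definition sg r : int := if num r < 0 then -1 else 1.

(** The determinant of [(1 - |s|, s)] and [(x, y)]. This direction has l1-norm one, so a
    displacement along it is measured by the increase of [index]. *)
Definition phi (s x y : R) : R := (1 - `|s|) * y - s * x.

Definition phiz (s : R) z : R := phi s z.1%:~R z.2%:~R.

(** The half keeps the roads of a level at a distance of order [N] from the origin, on which
    [blocks_wf] rests. *)
Definition lam r : R := lvlN (lvl r) * ((off r)%:~R + 2^-1).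

(** By [track_dist] the constrained quantity is [t - x], where [t] depends on the index only; the
    half-open interval forces [x = floor t], hence one vertex for each index. *)
Definition on r z : Prop :=
  valid r /\ 0 <= (sg r)%:~R * (phiz (slope r) z - lam r) < 1.

Definition index r z : int := z.1 + sg r * z.2.

(* The vertices of a road are indexed by [x + sg r * y], which increases by one
   at every step of the monotone staircase that they form. *)
Definition vertex r (i : int) : int * int :=
  let x := Num.floor (- (sg r)%:~R * lam r + i%:~R * (1 - `|slope r|)) in
  (x, sg r * (i - x)).

Definition dnorm r : R := enorm (1 - `|slope r|) (slope r).

(* Each increment of [time] has the form [40 + 20 * h], the length of a comb. *)
Definition time r (i : int) : int :=
  40 * i + 20 * Num.floor ((60 * dnorm r - 40) / 20 * i%:~R).

(** Parametrization of the line, scaled by 60, by arc length from its point [(- sg * lam, lam)] of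
    index 0. *)
Definition roadF r z : R * R :=
  (60 * (- (sg r)%:~R * lam r)
     + (time r (index r z))%:~R / dnorm r * (1 - `|slope r|),
   60 * lam r + (time r (index r z))%:~R / dnorm r * slope r).

Definition near (rho : R) z z' : Prop :=
  `|z.1%:~R - z'.1%:~R| <= rho /\ `|z.2%:~R - z'.2%:~R| <= rho.

Lemma near_sym rho z z' : near rho z z' -> near rho z' z.
Proof. by case=> h1 h2; split; rewrite distrC. Qed.

Lemma nearxx rho z : 0 <= rho -> near rho z z.
Proof. by move=> h; split; rewrite subrr normr0. Qed.

Lemma lvlM_ge1 j : 1 <= lvlM j.
Proof. by apply: exprn_ege1; rewrite ler1n. Qed.

Lemma lvlP_ge1 j : 1 <= lvlP j.
Proof. by apply: exprn_ege1; rewrite ler1n. Qed.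

Lemma lvlP_lt i j : (i < j)%N -> 2 * lvlP i <= lvlP j.
Proof.
move=> ij; rewrite /lvlP -exprS ler_weXn2l ?ler1n //; lia.
Qed.

Lemma lvlN_ge j : (0 < j)%N -> 8 * lvlP j <= lvlN j.
Proof.
move=> j0; rewrite /lvlP /lvlN.
have -> : 8 = 2 ^+ 3 :> R by rewrite -natrX.
rewrite -exprD ler_weXn2l ?ler1n //; lia.
Qed.

Lemma lvlP_ge j : j%:R <= lvlP j.
Proof.
rewrite /lvlP -natrX ler_nat.
apply: leq_trans (ltnW (ltn_expl j (isT : (1 < 2)%N))) _.
rewrite leq_exp2l //; lia.
Qed.

Lemma lvlM_int j : lvlM j = (2 ^+ (40 * j) : int)%:~R.
Proof. by rewrite /lvlM rmorphXn. Qed.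

Section Valid.
Variable r : road.
Hypothesis vr : valid r.

Lemma num_neq0 : num r != 0.
Proof. by case: vr => h _; apply/eqP => e; apply: h; rewrite e dvdz0. Qed.

Lemma lvl_gt0 : (0 < lvl r)%N.
Proof.
case: vr => _; case: (posnP (lvl r)) => // ->; rewrite muln0 expr0.
by have := num_neq0; lia.
Qed.

Lemma sgM (x : R) : (sg r)%:~R * ((sg r)%:~R * x) = x.
Proof. by rewrite /sg; case: ifP => _; rewrite ?mulN1r ?opprK ?mul1r. Qed.

Lemma sgMz (x : int) : sg r * (sg r * x) = x.
Proof. by rewrite /sg; case: ifP; lia. Qed.

Lemma norm_sgM (x : R) : `|(sg r)%:~R * x| = `|x|.
Proof. by rewrite /sg; case: ifP => _; rewrite ?mulN1r ?normrN ?mul1r. Qed.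

Lemma sg_slope : slope r = (sg r)%:~R * `|slope r|.
Proof.
rewrite /slope normrM normfV (ger0_norm (le_trans ler01 (lvlM_ge1 _))).
rewrite mulrA; congr (_ / _); rewrite /sg -intr_norm -intrM; congr (_%:~R).
by case: ifP; lia.
Qed.

Lemma slope_gt0 : (lvlM (lvl r))^-1 <= `|slope r|.
Proof.
have M0 : 0 < lvlM (lvl r) := lt_le_trans ltr01 (lvlM_ge1 _).
rewrite /slope normrM normfV (gtr0_norm M0); apply: ler_peMl.
  by rewrite invr_ge0 ltW.
rewrite -intr_norm ler1z; have := num_neq0; lia.
Qed.

Lemma slope_lt1 : `|slope r| <= 1 - (lvlM (lvl r))^-1.
Proof.
have M0 : 0 < lvlM (lvl r) := lt_le_trans ltr01 (lvlM_ge1 _).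
rewrite /slope normrM normfV (gtr0_norm M0) ler_pdivrMr // mulrBl mul1r.
rewrite mulVf ?gt_eqF // lvlM_int -intr_norm.
have : `|num r| <= 2 ^+ (40 * lvl r) - 1 by case: vr => _; lia.
by rewrite -(ler_int R) intrB.
Qed.

Lemma slope_bounds : 0 < `|slope r| < 1.
Proof.
have M0 : 0 < (lvlM (lvl r))^-1 by rewrite invr_gt0 (lt_le_trans _ (lvlM_ge1 _)).
have := slope_gt0; have := slope_lt1; lra.
Qed.

(** In fact [dnorm >= 1 / sqrt 2]. The bound [2 / 3] is what [time] calls for: it gives
    [60 * dnorm >= 40], so that the number of teeth is nonnegative. *)
Lemma dnorm_bounds : 2 / 3 <= dnorm r <= 1.
Proof.
have /andP[s0 s1] := slope_bounds.
have e : dnorm r ^+ 2 = (1 - `|slope r|) ^+ 2 + `|slope r| ^+ 2.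
  by rewrite sqr_enorm real_normK ?num_real.
have d0 : 0 <= dnorm r := enorm_ge0 _ _.
have half : 1 / 2 <= dnorm r ^+ 2.
  by rewrite e; have := sqr_ge0 (2 * `|slope r| - 1); lra.
have one : dnorm r ^+ 2 <= 1 by rewrite e; nra.
apply/andP; split; [have [//|h] := lerP (2 / 3) (dnorm r); nra|].
by rewrite -(@expr_le1 _ 2%N).
Qed.

Lemma vertex_index i : index r (vertex r i) = i.
Proof. by rewrite /index /vertex /= sgMz addrC subrK. Qed.

Lemma track_dist z :
  (sg r)%:~R * (phiz (slope r) z - lam r)
  = - (sg r)%:~R * lam r + (index r z)%:~R * (1 - `|slope r|) - z.1%:~R.
Proof.
rewrite /phiz /phi /index intrD intrM {2}sg_slope.
have := sgM 1; rewrite mulr1; set g := (sg r)%:~R => gg.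
have e : g * g * `|slope r| * z.1%:~R = `|slope r| * z.1%:~R.
  by rewrite gg mul1r.
by lra.
Qed.

Lemma vertex_on i : on r (vertex r i).
Proof.
split=> //; rewrite track_dist vertex_index /vertex /=.
set t := - _ * _ + _; have := floor_le t; have := floorD1_gt t.
by rewrite intrD; lra.
Qed.

Lemma vertex_succ i :
  (vertex r (i + 1)).1 = (vertex r i).1 + 1 /\
  (vertex r (i + 1)).2 = (vertex r i).2 \/
  (vertex r (i + 1)).1 = (vertex r i).1 /\
  (vertex r (i + 1)).2 = (vertex r i).2 + sg r.
Proof.
have /andP[s0 s1] := slope_bounds.
rewrite /vertex /= intrD mulrDl mul1r addrA; set t := _ + _ * _.
have h1 := floor_le t; have h2 := floorD1_gt t; rewrite intrD in h2.
have h3 : Num.floor t <= Num.floor (t + (1 - `|slope r|)) by apply: le_floor; lra.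
have h4 : Num.floor (t + (1 - `|slope r|)) <= Num.floor t + 1.
  rewrite -ltzD1 -(ltr_int R) !intrD.
  have := floor_le (t + (1 - `|slope r|)); lra.
have [e|e] : Num.floor (t + (1 - `|slope r|)) = Num.floor t \/
  Num.floor (t + (1 - `|slope r|)) = Num.floor t + 1 by lia.
- by right; rewrite e; split=> //; rewrite -[X in _ = _ + X]mulr1 -mulrDr; congr (_ * _); lia.
- by left; rewrite e; split=> //; congr (_ * _); lia.
Qed.

Lemma time_step i : exists h : nat, time r (i + 1) - time r i = (40 + 20 * h)%N.
Proof.
have /andP[d0 d1] := dnorm_bounds.
rewrite /time; set k := _ / 20.
rewrite (_ : k * (i + 1)%:~R = k * i%:~R + k); last by rewrite intrD; ring.
set t := k * _.
have k0 : 0 <= k by rewrite /k; lra.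
have : Num.floor t <= Num.floor (t + k) by apply: le_floor; lra.
move: (Num.floor t) (Num.floor (t + k)) => a b ab.
by exists `|b - a|%N; lia.
Qed.

Lemma time_close i : 60 * dnorm r * i%:~R - 20 <= (time r i)%:~R <= 60 * dnorm r * i%:~R.
Proof.
rewrite /time intrD !intrM /=; set t := _ / 20 * _.
have := floor_le t; have := floorD1_gt t; rewrite intrD.
have : t * 20 = (60 * dnorm r - 40) * i%:~R by rewrite /t; field.
by move=> e h1 h2; apply/andP; split; lra.
Qed.

Lemma roadF_step i :
  eucl_dist (roadF r (vertex r i)) (roadF r (vertex r (i + 1)))
  = (time r (i + 1) - time r i)%:~R.
Proof.
have /andP[d0 d1] := dnorm_bounds.
have dn : 0 < dnorm r by lra.
rewrite eucl_distC eucl_distE /roadF /= !vertex_index.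
set A := (time r (i + 1))%:~R; set B := (time r i)%:~R.
have -> : 60 * (- (sg r)%:~R * lam r) + A / dnorm r * (1 - `|slope r|)
  - (60 * (- (sg r)%:~R * lam r) + B / dnorm r * (1 - `|slope r|))
  = (A - B) / dnorm r * (1 - `|slope r|) by ring.
have -> : 60 * lam r + A / dnorm r * slope r - (60 * lam r + B / dnorm r * slope r)
  = (A - B) / dnorm r * slope r by ring.
rewrite enormZ -/(dnorm r) normrM normfV (gtr0_norm dn) divfK ?gt_eqF //.
by rewrite -rmorphB /= ger0_norm // ler0z; have [h ->] := time_step i.
Qed.

Lemma track_coord z : let e := (sg r)%:~R * (phiz (slope r) z - lam r) in
  z.1%:~R = - (sg r)%:~R * lam r + (index r z)%:~R * (1 - `|slope r|) - e /\
  z.2%:~R = lam r + (index r z)%:~R * slope r + (sg r)%:~R * e.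
Proof.
move=> e; rewrite /e track_dist; split; first by ring.
have -> : z.2%:~R = (sg r)%:~R * ((index r z)%:~R - z.1%:~R) :> R.
  by rewrite /index intrD intrM addrC addKr sgM.
rewrite {1}sg_slope; have := sgM 1; rewrite mulr1; set g := (sg r)%:~R => gg.
have : g * g * lam r = lam r by rewrite gg mul1r.
by lra.
Qed.

Lemma roadF_close z : on r z ->
  enorm ((roadF r z).1 - 60 * z.1%:~R) ((roadF r z).2 - 60 * z.2%:~R) <= 105.
Proof.
move=> [_]; have [] := track_coord z; rewrite /roadF /=; set i := index r z.
have /andP[d0 d1] := dnorm_bounds.
have dn : 0 < dnorm r by lra.
set e := _ * (phiz _ _ - _) => z1 z2 /andP[e0 e1].
set D := (time r i)%:~R - 60 * dnorm r * i%:~R.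
have hD : `|D| <= 20 by have := time_close i; rewrite /D ler_norml; lra.
have -> : 60 * (- (sg r)%:~R * lam r) + (time r i)%:~R / dnorm r * (1 - `|slope r|)
   - 60 * z.1%:~R = 60 * e + D / dnorm r * (1 - `|slope r|).
  by rewrite z1 /D; field; rewrite gt_eqF.
have -> : 60 * lam r + (time r i)%:~R / dnorm r * slope r - 60 * z.2%:~R
  = 60 * (- ((sg r)%:~R * e)) + D / dnorm r * slope r.
  by rewrite z2 /D; field; rewrite gt_eqF.
apply: le_trans (enormD _ _ _ _) _.
(* [85 >= 60 * sqrt 2]: the vertex is off the line by less than one in each coordinate. The other 20
   of 105 is the rounding in [time]. *)
have h1 : enorm (60 * e) (60 * - ((sg r)%:~R * e)) <= 85.
  apply: enorm_le => //.
  have e2 : ((sg r)%:~R * e) ^+ 2 = e ^+ 2.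
    by rewrite -real_normK ?num_real // norm_sgM real_normK ?num_real.
  have e3 : e ^+ 2 <= 1 by nra.
  rewrite (_ : (60 * - _) ^+ 2 = 3600 * e ^+ 2); last by rewrite -e2; ring.
  by rewrite exprMn; lra.
have h2 : enorm (D / dnorm r * (1 - `|slope r|)) (D / dnorm r * slope r) <= 20.
  by rewrite enormZ -/(dnorm r) normrM normfV (gtr0_norm dn) divfK ?gt_eqF.
by lra.
Qed.

End Valid.

Lemma phi_le (s B x y : R) : `|s| <= 1 -> `|x| <= B -> `|y| <= B -> `|phi s x y| <= B.
Proof.
move=> s1 z1 z2; rewrite /phi; apply: le_trans (ler_normB _ _) _.
rewrite !normrM; have s0 := normr_ge0 s.
rewrite (ger0_norm (_ : 0 <= 1 - `|s|)); last by lra.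
by nra.
Qed.

Lemma on_far r z (B : R) : on r z -> `|z.1%:~R| <= B + lvlP (lvl r) ->
  `|z.2%:~R| <= B + lvlP (lvl r) -> (lvl r)%:R <= B.
Proof.
move=> [vr h] z1 z2.
have /andP[s0 s1] := slope_bounds vr.
have := phi_le (ltW s1) z1 z2; rewrite -/(phiz _ _).
have h' : `|phiz (slope r) z - lam r| <= 1.
  by rewrite -(norm_sgM r) ger0_norm; lra.
have lamN : lvlN (lvl r) / 2 <= `|lam r|.
  have N0 : 0 < lvlN (lvl r) by rewrite exprn_gt0.
  rewrite /lam normrM (gtr0_norm N0) ler_pM2l //.
  have [|] := lerP 0 (off r) => ho.
    have : 0 <= (off r)%:~R :> R by rewrite ler0z.
    by move=> ?; rewrite ger0_norm; lra.
  have : (off r)%:~R <= -1 :> R by have := ler_int R (off r) (-1); rewrite rmorphN1 => ->; lia.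
  by move=> ?; rewrite ler0_norm; lra.
have := lvlN_ge (lvl_gt0 vr); have := lvlP_ge1 (lvl r); have := lvlP_ge (lvl r).
have := ler_normB (phiz (slope r) z) (phiz (slope r) z - lam r).
rewrite opprB addrC subrK; lra.
Qed.

(** Within a level there is no priority: two roads that come close both give way, whether or not the
    other one is active. *)
Definition pruned r z : Prop := on r z /\
  forall r' z', on r' z' -> lvl r' = lvl r -> r' <> r -> ~ near (lvlP (lvl r)) z z'.

Definition blocks (y x : road * (int * int)) : Prop :=
  [/\ pruned y.1 y.2, (lvl x.1 < lvl y.1)%N & near (lvlP (lvl x.1)) x.2 y.2].

(* A chain of blocking points has increasing levels and stays within [B + P] of
   the axes, whereas the roads of level [j] avoid a square of side about [N]
   around the origin. *)
Lemma blocks_wf : well_founded blocks.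
Proof.
move=> [r0 z0].
have [n hn] : exists n : nat, `|z0.1%:~R| <= n%:R :> R /\ `|z0.2%:~R| <= n%:R :> R.
  exists (`|z0.1| + `|z0.2|)%N.
  by rewrite -!intr_norm -!natr_absz !ler_nat leq_addr leq_addl.
suff H m r z : `|z.1%:~R| <= n%:R + lvlP (lvl r) -> `|z.2%:~R| <= n%:R + lvlP (lvl r) ->
    (n <= lvl r + m)%N -> Acc blocks (r, z).
  apply: (H n); last exact: leq_addl.
    by case: hn => h _; have := lvlP_ge1 (lvl r0); lra.
  by case: hn => _ h; have := lvlP_ge1 (lvl r0); lra.
elim: m r z => [|m IHm] r z h1 h2 hm; constructor=> -[r' z'] [/= [on' _] lt [n1 n2]].
all: have P2 := lvlP_lt lt.
all: have z1' : `|z'.1%:~R| <= n%:R + lvlP (lvl r').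
1,3: have := ler_normB (z.1%:~R : R) (z.1%:~R - z'.1%:~R); rewrite opprB addrC subrK; lra.
all: have z2' : `|z'.2%:~R| <= n%:R + lvlP (lvl r').
1,3: have := ler_normB (z.2%:~R : R) (z.2%:~R - z'.2%:~R); rewrite opprB addrC subrK; lra.
- by have := on_far on' z1' z2'; rewrite ler_nat; clear -lt hm; lia.
- by apply: IHm => //; clear -lt hm; lia.
Qed.

Lemma road_drawing :
  exists (act : road -> int * int -> Prop) (F : int * int -> R * R),
  [/\ forall z, enorm ((F z).1 - 60 * z.1%:~R) ((F z).2 - 60 * z.2%:~R) <= 105,
      forall r z, act r z -> on r z /\ F z = roadF r z,
      forall r z r' z', act r z -> act r' z' -> (lvl r <= lvl r')%N ->
        near (lvlP (lvl r)) z z' -> r = r'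
    & forall r z, on r z -> ~ act r z ->
        exists r' z', [/\ near (lvlP (lvl r)) z z', on r' z', r' <> r
          & lvl r' = lvl r \/ (lvl r < lvl r')%N /\ act r' z'] ].
Proof.
have [A AP] := wf_kernel (fun x => pruned x.1 x.2) blocks_wf.
pose act r z := A (r, z).
have act_inj r z r' z' : act r z -> act r' z' -> (lvl r <= lvl r')%N ->
    near (lvlP (lvl r)) z z' -> r = r'.
  move=> /AP[[/= o1 p1] b1] a2; have /AP[[/= o2 p2] b2] := a2.
  rewrite leq_eqVlt => /orP[/eqP e|lt] nr.
    by apply: contrapT => ne; apply: (p1 r' z') => //; exact: nesym.
  by case: (b1 (r', z')).
(* By [act_inj] at most one road is active at a point, so the choice made by [cid] is immaterial. *)
pose F z : R * R := if pselect (exists r, act r z) is left e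
  then roadF (sval (cid e)) z else (60 * z.1%:~R, 60 * z.2%:~R).
exists act, F; split.
- move=> z; rewrite /F; case: pselect => [e|_] /=.
    case: (cid e) => r /= /AP[[/= [vr o] _] _].
    by apply: roadF_close.
  by rewrite !subrr /enorm expr0n addr0 sqrtr0.
- move=> r z a; split; first by have /AP[[]] := a.
  rewrite /F; case: pselect => [e|]; last by case; exists r.
  case: (cid e) => r' /= a'; congr (roadF _ z).
  have nn k : near (lvlP k) z z by apply: nearxx; exact: le_trans (lvlP_ge1 k).
  by case: (leqP (lvl r') (lvl r)) => h; [|symmetry];
    apply: act_inj (nn _) => //; exact: ltnW.
- exact: act_inj.
- move=> r z o na; apply: contrapT => h; apply: na; apply/AP; split=> /=.
    split=> // r' z' o' e ne nr; apply: h; exists r', z'; split=> //; by left.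
  move=> [r' z'] [[/= o' _] /= lt nr] a'; apply: h; exists r', z'; split=> //.
    by move=> e; rewrite e ltnn in lt.
  by right.
Qed.

End Roads.

(** * Counting lattice points near lines *)

Lemma count_span (p : pred nat) (L n : nat) :
  (forall m m', p m -> p m' -> (m' <= m + L)%N) -> (count p (iota 0 n) <= L.+1)%N.
Proof.
move=> h; case: (posnP (count p (iota 0 n))) => [->//|].
rewrite -has_count => /hasP[m0 _ pm0].
have [m pm mmin] := ex_minnP (ex_intro p m0 pm0).
rewrite -size_filter -(size_iota m L.+1).
apply: uniq_leq_size; first by rewrite filter_uniq ?iota_uniq.
move=> x; rewrite mem_filter !mem_iota => /andP[px _].
by rewrite mmin //= addnS ltnS h.
Qed.

Lemma count_has_le (T I : Type) (p : pred T) (q : I -> pred T) (cs : seq I) s :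
  (forall x, p x -> has (fun c => q c x) cs) ->
  (count p s <= \sum_(c <- cs) count (q c) s)%N.
Proof.
move=> h; apply: leq_trans (sub_count h s) _.
elim: cs {h} => [|c cs IHcs] /=; first by rewrite count_pred0.
rewrite big_cons; apply: leq_trans (leq_add (leqnn _) IHcs).
by rewrite -(count_predUI (q c)); exact: leq_addr.
Qed.

Lemma count_has_le_const (R : realDomainType) (T I : Type) (p : pred T)
    (q : I -> pred T) (cs : seq I) s (B : R) :
  (forall x, p x -> has (fun c => q c x) cs) ->
  (forall c, (count (q c) s)%:R <= B) ->
  (count p s)%:R <= (size cs)%:R * B.
Proof.
move=> h hB; apply: le_trans (_ : (\sum_(c <- cs) count (q c) s)%:R <= _).
  by rewrite ler_nat; exact: count_has_le.
elim: cs {h} => [|c cs IHcs]; first by rewrite big_nil mul0r.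
by rewrite big_cons natrD /= -natr1 mulrDl mul1r addrC lerD.
Qed.

Section Counting.
Variable R : realType.

Lemma count_strip (A th mu tau M : R) n : 0 <= tau -> 0 < M -> M^-1 <= `|th| ->
  (count (fun m => `|A + m%:R * th - mu| <= tau) (iota 0 n))%:R
    <= 2 * tau * M + 1.
Proof.
move=> tau0 M0 th_ge.
have T0 : 0 <= 2 * tau * M by rewrite !mulr_ge0 // ltW.
apply: le_trans (_ : (Num.truncn (2 * tau * M)).+1%:R <= _); last first.
  by rewrite -natr1 lerD2r truncn_le.
rewrite ler_nat; apply: count_span => m m' h1 h2.
rewrite -leq_subLR; have [|mm] := leqP m' m; first by rewrite -subn_eq0 => /eqP->.
rewrite (truncn_ge_nat _ T0) (natrB _ (ltnW mm)).
have d0 : 0 <= m'%:R - m%:R :> R by rewrite subr_ge0 ler_nat ltnW.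
have : `|th| * (m'%:R - m%:R) <= 2 * tau.
  rewrite -(ger0_norm d0) -normrM.
  have := ler_normB (A + m'%:R * th - mu) (A + m%:R * th - mu).
  rewrite (_ : A + m'%:R * th - mu - (A + m%:R * th - mu) = th * (m'%:R - m%:R)).
    by lra.
  by ring.
move=> h; rewrite -ler_pdivrMr // mulrC.
by apply: le_trans h; apply: ler_wpM2r.
Qed.

(** In [n] steps of size at most one the value meets about [2 * (n + tau) / N] strips at most. Each
    holds few values by [count_strip], since consecutive ones are at least [1 / M] apart. *)
Lemma count_strips (A th N tau M : R) n :
  0 <= tau -> 0 < M -> 0 < N -> M^-1 <= `|th| -> `|th| <= 1 ->
  (count (fun m => `[< exists c : int,
      `|A + m%:R * th - N * (c%:~R + 2^-1)| <= tau >]) (iota 0 n))%:R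
    <= (2 * (n%:R + tau) / N + 3) * (2 * tau * M + 1).
Proof.
move=> tau0 M0 N0 th_ge th1.
set x := (A - n%:R - tau) / N - 2^-1.
set W := 2 * (n%:R + tau) / N.
have W0 : 0 <= W by rewrite divr_ge0 ?mulr_ge0 ?addr_ge0 // ltW.
pose L := (Num.truncn W + 3)%N.
have LW : L%:R <= W + 3 by rewrite natrD lerD2r truncn_le.
pose q (e : nat) m := (m < n)%N &&
  (`|A + m%:R * th - N * ((Num.floor x + e%:Z)%:~R + 2^-1)| <= tau).
pose p m := (m < n)%N && `[< exists c : int,
      `|A + m%:R * th - N * (c%:~R + 2^-1)| <= tau >].
have -> : count (fun m => `[< exists c : int,
      `|A + m%:R * th - N * (c%:~R + 2^-1)| <= tau >]) (iota 0 n)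
    = count p (iota 0 n).
  by apply: eq_in_count => m; rewrite mem_iota /p /= => ->.
have T1 : 0 <= 2 * tau * M + 1 by rewrite addr_ge0 // !mulr_ge0 // ltW.
apply: le_trans (_ : (size (iota 0 L))%:R * (2 * tau * M + 1) <= _); last first.
  by rewrite size_iota ler_wpM2r.
apply: (@count_has_le_const _ _ _ _ q).
- move=> m /andP[mn /asboolP[c hc]]; apply/hasP.
  have mR : m%:R * `|th| <= n%:R.
    apply: le_trans (_ : m%:R <= _); last by rewrite ler_nat ltnW.
    by rewrite ler_piMr.
  have mth : `|m%:R * th| <= n%:R by rewrite normrM normr_nat.
  have c1 : N * x <= N * c%:~R.
    rewrite /x mulrBr mulrCA divff ?gt_eqF //.
    by move: hc mth; rewrite !ler_norml; lra.
  have c2 : N * c%:~R <= N * (x + W).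
    rewrite /x /W mulrDr mulrBr !(mulrCA N) !divff ?gt_eqF //.
    by move: hc mth; rewrite !ler_norml; lra.
  rewrite !ler_pM2l // in c1 c2.
  have c3 : Num.floor x <= c by rewrite -(ler_int R); have := floor_le x; lra.
  have cE : Num.floor x + `|c - Num.floor x|%N%:Z = c.
    by move: (Num.floor x) c3 => f; clear; lia.
  exists `|c - Num.floor x|%N; last by rewrite /q mn cE.
  rewrite mem_iota /= add0n /L -ltnS -addnS.
  have : (`|c - Num.floor x|%N)%:R < (Num.truncn W + 3)%:R :> R.
    rewrite natr_absz intr_norm ger0_norm ?ler0z ?subr_ge0 // intrB natrD.
    have := truncnS_gt W; rewrite -natr1; have := floorD1_gt x; rewrite intrD; lra.
  by rewrite ltr_nat; clear; lia.
- move=> e; apply: le_trans (count_strip A (N * ((Num.floor x + e%:Z)%:~R + 2^-1)) n tau0 M0 th_ge).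
  by rewrite ler_nat; apply: sub_count => m /andP[].
Qed.

End Counting.

Section Det.
Variable R : realType.
Implicit Types (r : road) (z : int * int).

Local Notation slope := (slope R).
Local Notation lvlM := (lvlM R).

Definition dt (s s' : R) : R := phi s (1 - `|s'|) s'.

Lemma dt_ge r r' : valid r -> valid r' -> (lvl r <= lvl r')%N ->
  (lvl r = lvl r' -> num r <> num r') ->
  (lvlM (lvl r'))^-1 <= `|dt (slope r') (slope r)|.
Proof.
move=> vr vr' ll' ne; set d := (_ ^-1).
have M0 j : 0 < lvlM j by rewrite exprn_gt0.
have d0 : 0 < d by rewrite invr_gt0.
have diff : d <= `|slope r - slope r'|.
  have e : lvlM (lvl r') = 2 ^+ (40 * (lvl r' - lvl r)) * lvlM (lvl r).
    by rewrite /lvlM -exprD; congr (_ ^+ _); clear -ll'; lia.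
  pose k : int := num r * 2 ^+ (40 * (lvl r' - lvl r)) - num r'.
  have -> : slope r - slope r' = k%:~R / lvlM (lvl r').
    rewrite /slope /k intrB intrM rmorphXn /= mulrBl; congr (_ - _).
    by rewrite e; field; rewrite !gt_eqF ?exprn_gt0.
  rewrite normrM normfV (gtr0_norm (M0 _)); apply: ler_peMl; first exact: ltW.
  rewrite -intr_norm ler1z.
  suff : k <> 0 by move: k {e} => k; clear; lia.
  rewrite /k; move/eqP; rewrite subr_eq0 => /eqP E.
  move: ll'; rewrite leq_eqVlt => /orP[/eqP l|l].
    by apply: ne => //; rewrite -E l subnn muln0 expr0 mulr1.
  (* At distinct levels, one numerator over the common denominator is even and the other one odd. *)
  case: vr' => + _; apply; rewrite -E.
  have -> : (40 * (lvl r' - lvl r) = (40 * (lvl r' - lvl r)).-1.+1)%N by clear -l; lia.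
  by rewrite exprS mulrCA dvdz_mulr.
have := slope_gt0 R vr'; have := slope_lt1 R vr'; rewrite -/d.
have /andP[s0 s1] := slope_bounds R vr.
move: (slope r) (slope r') diff s0 s1 => s s' diff s0 s1 s's s'1.
rewrite /dt /phi.
(* For opposite signs the determinant is, up to sign, a convex combination of [|s'|] and [1 - |s'|],
   both at least [1 / M]. *)
have [ps|ps] := lerP 0 s; have [ps'|ps'] := lerP 0 s'.
- rewrite (ger0_norm ps) (ger0_norm ps') in s0 s1 s's s'1 *.
  by rewrite (_ : _ - _ = s - s'); last ring.
- rewrite (ger0_norm ps) (ltr0_norm ps') in s0 s1 s's s'1 *.
  by rewrite ler_normr; apply/orP; left; nra.
- rewrite (ltr0_norm ps) (ger0_norm ps') in s0 s1 s's s'1 *.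
  by rewrite ler_normr; apply/orP; right; nra.
- rewrite (ltr0_norm ps) (ltr0_norm ps') in s0 s1 s's s'1 *.
  by rewrite (_ : _ - _ = s - s'); last ring.
Qed.

Lemma dt_le1 r r' : valid r -> valid r' -> `|dt (slope r') (slope r)| <= 1.
Proof.
move=> vr vr'; have /andP[s0 s1] := slope_bounds R vr.
have /andP[s0' s1'] := slope_bounds R vr'.
apply: phi_le; [exact: ltW| |exact: ltW].
by rewrite ger0_norm; lra.
Qed.

Lemma near_line r' z z' (rho : R) : on R r' z' -> near rho z z' ->
  `|phiz (slope r') z - lam R r'| <= rho + 1.
Proof.
move=> [vr' h] [n1 n2].
have h1 : `|phiz (slope r') z' - lam R r'| <= 1.
  by rewrite -(norm_sgM r') ger0_norm; lra.
have /andP[s0' s1'] := slope_bounds R vr'.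
have := phi_le (ltW s1') n1 n2.
have := ler_normD (phi (slope r') (z.1%:~R - z'.1%:~R) (z.2%:~R - z'.2%:~R))
  (phiz (slope r') z' - lam R r').
rewrite (_ : phi _ _ _ + _ = phiz (slope r') z - lam R r').
  by lra.
by rewrite /phiz /phi; ring.
Qed.

Lemma phiz_vertex r r' (i : int) : valid r -> valid r' ->
  `|phiz (slope r') (vertex R r i)
    - (phi (slope r') (- (sg r)%:~R * lam R r) (lam R r)
       + i%:~R * dt (slope r') (slope r))| <= 1.
Proof.
move=> vr vr'; have [_ on_i] := vertex_on R vr i.
have [] := @track_coord R r (vertex R r i); rewrite vertex_index.
set e := _ * (phiz _ _ - _) in on_i * => z1 z2.
have /andP[s0' s1'] := slope_bounds R vr'.
have e1 : `|- e| <= 1 by rewrite normrN ger0_norm; lra.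
have e2 : `|(sg r)%:~R * e| <= 1 by rewrite norm_sgM -normrN.
have := phi_le (ltW s1') e1 e2; congr (`| _ | <= _).
by rewrite /phiz z1 z2 /dt /phi; ring.
Qed.

End Det.

(** * Travelling along a road *)

Lemma normB_unit_le (R : realDomainType) (e x b : R) :
  0 <= e < 1 -> `|x| <= b -> `|e - x| <= b + 1.
Proof.
by case/andP=> e0 e1 xb; apply: le_trans (ler_normB _ _) _; rewrite ger0_norm //; lra.
Qed.

(** The arithmetic of [far_choice]. As [2 P + 3 <= 5 / 8 * N], one gets [3 / 8 * N * E <= 2 * W * t
    * E <= 12 * P * W], whence the 32. *)
Lemma far_absurd (R : realFieldType) (N P W E t a b x : R) :
  1 <= P -> 8 * P <= N -> 0 <= E -> 0 <= W -> 0 <= t -> t * E <= 2 * P + 4 ->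
  N - 1 <= a -> a <= b + t * x -> b <= 2 * P + 2 -> x <= 2 * W ->
  32 * P * W < N * E -> False.
Proof.
move=> P1 N8 E0 W0 t0 tE Na ab bP xW.
have tx := ler_wpM2l t0 xW.
have h1 : 3 / 8 * N * E <= t * (2 * W) * E by apply: ler_wpM2r => //; lra.
have h2 := ler_wpM2r W0 tE.
have h3 : (2 * P + 4) * W <= 6 * P * W by apply: ler_wpM2r => //; lra.
by lra.
Qed.

Section Travel.
Variable R : realType.
Variable F : int * int -> R * R.
Hypothesis F_close :
  forall z, enorm ((F z).1 - 60 * z.1%:~R) ((F z).2 - 60 * z.2%:~R) <= 105.
Variable act : road -> int * int -> Prop.
Hypothesis act_F : forall r z, act r z -> on R r z /\ F z = roadF R r z.
Hypothesis act_near : forall r z r' z', act r z -> act r' z' ->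
  (lvl r <= lvl r')%N -> near (lvlP R (lvl r)) z z' -> r = r'.
Hypothesis act_blocked : forall r z, on R r z -> ~ act r z ->
  exists r' z', [/\ near (lvlP R (lvl r)) z z', on R r' z', r' <> r
    & lvl r' = lvl r \/ (lvl r < lvl r')%N /\ act r' z'].

Implicit Types (r : road) (z : int * int).

Local Notation slope := (slope R).
Local Notation lvlM := (lvlM R).
Local Notation lvlN := (lvlN R).
Local Notation lvlP := (lvlP R).
Local Notation vertex := (vertex R).

Lemma road_eq r r' : lvl r = lvl r' -> num r' = num r -> off r' = off r -> r' = r.
Proof. by case: r r' => ? ? ? [? ? ?] /= -> -> ->. Qed.

Definition creach z z' (c : R) := reach (fine_edge F_close) (coarse z) (coarse z') c.

Lemma creach_sym z z' c : creach z z' c -> creach z' z c.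
Proof. by apply: reach_sym; exact: fine_edge_sym. Qed.

Lemma creach_row (x y : int) (n : nat) : creach (x, y) (x + n%:Z, y) (280 * n%:R).
Proof.
elim: n => [|n IHn]; first by rewrite addr0; apply: reach_refl; rewrite mulr0.
rewrite -[n.+1%:R]natr1 mulrDr mulr1; apply: reach_trans IHn _.
have -> : (x + n.+1%:Z, y) = nbr false (x + n%:Z, y).
  by rewrite /nbr /=; congr pair; clear; lia.
exact: reach_nbr280.
Qed.

Lemma creach_col (x y : int) (n : nat) : creach (x, y) (x, y + n%:Z) (280 * n%:R).
Proof.
elim: n => [|n IHn]; first by rewrite addr0; apply: reach_refl; rewrite mulr0.
rewrite -[n.+1%:R]natr1 mulrDr mulr1; apply: reach_trans IHn _.
have -> : (x, y + n.+1%:Z) = nbr true (x, y + n%:Z).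
  by rewrite /nbr /=; congr pair; clear; lia.
exact: reach_nbr280.
Qed.

Lemma creach_lattice z z' (c : R) :
  `|z.1%:~R - z'.1%:~R| + `|z.2%:~R - z'.2%:~R| <= c -> creach z z' (280 * c).
Proof.
case: z z' => x y [x' y'] /= h.
have dE (a b : int) : `|a%:~R - b%:~R| = (`|a - b|%N)%:R :> R.
  by rewrite natr_absz intr_norm intrB.
have shift (a b : int) : b = a + `|a - b|%N%:Z \/ a = b + `|a - b|%N%:Z.
  by clear; lia.
have row : creach (x, y) (x', y) (280 * `|x%:~R - x'%:~R|).
  rewrite dE; case: (shift x x') => {1}->; first exact: creach_row.
  by apply: creach_sym; exact: creach_row.
have col : creach (x', y) (x', y') (280 * `|y%:~R - y'%:~R|).
  rewrite dE; case: (shift y y') => {1}->; first exact: creach_col.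
  by apply: creach_sym; exact: creach_col.
by apply: reach_le (reach_trans row col); lra.
Qed.

Lemma creach_vertex_step r (i : int) (c : R) : valid r ->
  c = 280 \/ [/\ c = (time R r (i + 1) - time R r i)%:~R, act r (vertex r i)
                & act r (vertex r (i + 1))] ->
  creach (vertex r i) (vertex r (i + 1)) c.
Proof.
move=> vr hc.
have key z z' d : z' = nbr d z -> z = vertex r i /\ z' = vertex r (i + 1) \/
    z' = vertex r i /\ z = vertex r (i + 1) -> creach z z' c.
  move=> -> zz'; case: hc => [->|[-> a1 a2]]; first exact: reach_nbr280.
  have [h th] := time_step R vr i; rewrite th.
  apply: reach_nbr_le; rewrite pmulrn -th -roadF_step //.
  have [_ F1] := act_F a1; have [_ F2] := act_F a2.
  case: zz' => -[zE z'E].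
    by rewrite z'E zE F1 F2.
  by rewrite zE z'E F1 F2 eucl_distC.
have eta z a b : z.1 = a -> z.2 = b -> z = (a, b) by case: z => /= ? ? -> ->.
have [[v1 v2]|[v1 v2]] := vertex_succ R vr i.
  by apply: (@key _ _ false); [exact: eta | left].
move: v2; rewrite /sg; case: ifP => _ v2.
  apply: creach_sym; apply: (@key _ _ true); last by right.
  by apply: eta; rewrite ?v1 // v2 subrK.
by apply: (@key _ _ true); [exact: eta | left].
Qed.

Definition bad r (i : int) : bool := ~~ `[< act r (vertex r i) >].

Lemma road_travel r (i0 : int) (n : nat) : valid r ->
  creach (vertex r i0) (vertex r (i0 + n%:Z))
    ((time R r (i0 + n%:Z) - time R r i0)%:~R
     + 560 * (count (fun m : nat => bad r (i0 + m%:Z)) (iota 0 n.+1))%:R).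
Proof.
move=> vr.
pose cnt n := count (fun m : nat => bad r (i0 + m%:Z)) (iota 0 n.+1).
rewrite -/(cnt n).
(* Each inactive vertex pays 280 for either step at it; the invariant withholds the share of the
   last vertex that pays for the step to come. *)
suff H : creach (vertex r i0) (vertex r (i0 + n%:Z))
    ((time R r (i0 + n%:Z) - time R r i0)%:~R + 560 * (cnt n)%:R
      - 280 * (bad r (i0 + n%:Z))%:R).
  apply: reach_le H; have := ler0n R (bad r (i0 + n%:Z)); lra.
elim: n => [|n IHn].
  rewrite /cnt /= !addr0 subrr addn0; apply: reach_refl.
  by have := ler0n R (bad r i0); lra.
have cntS : cnt n.+1 = (cnt n + bad r (i0 + n.+1%:Z))%N.
  by rewrite /cnt -[n.+2]addn1 iotaD count_cat /= addn0.
have iS : i0 + n.+1%:Z = i0 + n%:Z + 1 by clear; lia.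
have tS : (time R r (i0 + n.+1%:Z) - time R r i0)%:~R
   = (time R r (i0 + n%:Z) - time R r i0)%:~R
     + (time R r (i0 + n%:Z + 1) - time R r (i0 + n%:Z))%:~R :> R.
  by rewrite -intrD iS; congr (_%:~R); ring.
have t0 : 0 <= (time R r (i0 + n%:Z + 1) - time R r (i0 + n%:Z))%:~R :> R.
  by have [h ->] := time_step R vr (i0 + n%:Z); rewrite ler0z.
rewrite tS cntS natrD.
have [a1|a1] := asboolP (act r (vertex r (i0 + n%:Z)));
  have [a2|a2] := asboolP (act r (vertex r (i0 + n.+1%:Z))).
- have b2 : bad r (i0 + n.+1%:Z) = false by apply/negbF/asboolP.
  have st : creach (vertex r (i0 + n%:Z)) (vertex r (i0 + n.+1%:Z))
      (time R r (i0 + n%:Z + 1) - time R r (i0 + n%:Z))%:~R.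
    by rewrite iS; apply: creach_vertex_step => //; right; rewrite -iS.
  apply: reach_le (reach_trans IHn st); rewrite b2 /=.
  by have := ler0n R (bad r (i0 + n%:Z)); lra.
all: have st : creach (vertex r (i0 + n%:Z)) (vertex r (i0 + n.+1%:Z)) 280
  by rewrite iS; apply: creach_vertex_step => //; left.
all: apply: reach_le (reach_trans IHn st).
all: have := ler0n R (bad r (i0 + n%:Z)); have := ler0n R (bad r (i0 + n.+1%:Z)).
- by have -> : bad r (i0 + n.+1%:Z) = true; [exact/asboolPn | rewrite /=; lra].
- by have -> : bad r (i0 + n%:Z) = true; [exact/asboolPn | rewrite /=; lra].
- by have -> : bad r (i0 + n%:Z) = true; [exact/asboolPn | rewrite /=; lra].
Qed.

(* Vertices of [r] lost to roads of comparable level, which are few by counting,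
   and to those of much higher level, of which at most one comes near. *)
Definition near_bad r (i : int) : bool := `[< exists r' z',
  [/\ (lvl r <= lvl r')%N, (2 * lvl r' < 5 * lvl r)%N, r' <> r, on R r' z'
    & near (lvlP (lvl r)) (vertex r i) z'] >].

Definition far_bad r (i : int) : bool := `[< exists r' z',
  [/\ (5 * lvl r <= 2 * lvl r')%N, act r' z'
    & near (lvlP (lvl r)) (vertex r i) z'] >].

Lemma bad_split r i : valid r -> bad r i -> near_bad r i || far_bad r i.
Proof.
move=> vr /asboolPn na.
have [r' [z' [nr o' ne h]]] := act_blocked (vertex_on R vr i) na.
have ll' : (lvl r <= lvl r')%N by case: h => [->|[/ltnW]].
have k0 := lvl_gt0 vr.
apply/orP; case: (ltnP (2 * lvl r') (5 * lvl r)) => hl.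
  by left; apply/asboolP; exists r', z'.
right; apply/asboolP; exists r', z'; split=> //; case: h => [e|[]] //.
by clear -e hl k0; lia.
Qed.

Lemma count_bad r i0 n : valid r ->
  (count (fun m : nat => bad r (i0 + m%:Z)) (iota 0 n)
   <= count (fun m : nat => near_bad r (i0 + m%:Z)) (iota 0 n)
      + count (fun m : nat => far_bad r (i0 + m%:Z)) (iota 0 n))%N.
Proof.
move=> vr; set s := iota 0 n.
rewrite -count_predUI; apply: leq_trans (leq_addr _ _).
by apply: sub_count => m; exact: bad_split.
Qed.

Lemma strip_point r r' i z' (rho : R) : valid r -> on R r' z' ->
  near rho (vertex r i) z' ->
  `|phi (slope r') (- (sg r)%:~R * lam R r) (lam R r)
    + i%:~R * dt (slope r') (slope r) - lam R r'| <= rho + 2.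
Proof.
move=> vr o' nr; have vr' : valid r' by case: o'.
have h1 := near_line o' nr; have h2 := phiz_vertex R i vr vr'.
by move: h1 h2; rewrite !ler_norml; lra.
Qed.

(** This sums over the at most [2 * M] directions of level [j]. Crossings contribute through
    [M ^ 2 / N <= 2 ^ (- 280 k)], using [k <= j], and the boundary terms of the directions through
    [M ^ 2 <= 2 ^ (200 k)], using [j < 5 k / 2]. *)
Lemma level_bound k j (n tau : R) : (0 < k)%N -> (k <= j)%N -> (2 * j < 5 * k)%N ->
  0 <= n -> 1 <= tau ->
  2 * lvlM j * ((2 * (n + tau) / lvlN j + 3) * (2 * tau * lvlM j + 1))
  <= 6 * tau * (2 * (n + tau) / 2 ^+ (280 * k) + 3 * 2 ^+ (200 * k)).
Proof.
move=> k0 kj jk n0 tau1.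
have M1 := lvlM_ge1 R j.
have N0 : 0 < lvlN j by rewrite exprn_gt0.
have M2 : lvlM j ^+ 2 <= 2 ^+ (200 * k).
  rewrite /lvlM -exprM ler_weXn2l ?ler1n //; clear -jk; lia.
have MN : lvlM j ^+ 2 / lvlN j <= (2 ^+ (280 * k))^-1.
  rewrite ler_pdivrMr // mulrC ler_pdivlMr ?exprn_gt0 //.
  rewrite /lvlM /lvlN -exprM -exprD ler_weXn2l ?ler1n //; clear -kj; lia.
have s1 : 2 * tau * lvlM j + 1 <= 3 * tau * lvlM j by nra.
have q0 : 0 <= 2 * (n + tau) / lvlN j + 3.
  by rewrite addr_ge0 // divr_ge0 ?mulr_ge0 // ?addr_ge0 // ?ltW //; lra.
apply: le_trans (_ : 2 * lvlM j * ((2 * (n + tau) / lvlN j + 3) * (3 * tau * lvlM j)) <= _).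
  apply: ler_wpM2l; first lra.
  exact: ler_wpM2l.
rewrite (_ : 2 * lvlM j * _ = 6 * tau * (2 * (n + tau) * (lvlM j ^+ 2 / lvlN j)
   + 3 * lvlM j ^+ 2)); last by ring.
apply: ler_wpM2l; first lra.
apply: lerD; last by rewrite ler_pM2l.
by apply: ler_wpM2l => //; lra.
Qed.

Definition near_bad_bound (k n : nat) : R :=
  (2 * k)%:R * (6 * (lvlP k + 2)
    * (2 * (n%:R + (lvlP k + 2)) / 2 ^+ (280 * k) + 3 * 2 ^+ (200 * k))).

Lemma count_near_bad r (i0 : int) (n : nat) : valid r ->
  (count (fun m : nat => near_bad r (i0 + m%:Z)) (iota 0 n))%:R
  <= near_bad_bound (lvl r) n.
Proof.
move=> vr; rewrite /near_bad_bound; set k := lvl r; set tau := lvlP k + 2.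
have k0 : (0 < k)%N := lvl_gt0 vr.
have P1 := lvlP_ge1 R (lvl r).
have tau1 : 1 <= tau by rewrite /tau; lra.
(* The offset 0 is a placeholder: validity and slope depend on the level and the numerator only. *)
pose dirs j b := Road j b 0.
pose A s := phi s (- (sg r)%:~R * lam R r) (lam R r) + i0%:~R * dt s (slope r).
pose hit (r' : road) (m : nat) := `[< exists c : int,
  `|A (slope r') + m%:R * dt (slope r') (slope r) - lvlN (lvl r') * (c%:~R + 2^-1)| <= tau >].
pose q j (m : nat) := [&& (k <= j)%N, (2 * j < 5 * k)%N & `[< exists b : int,
  [/\ valid (dirs j b), (lvl r = j -> num r <> b) & hit (dirs j b) m] >]].
have B0 : 0 <= 6 * tau * (2 * (n%:R + tau) / 2 ^+ (280 * k) + 3 * 2 ^+ (200 * k)).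
  rewrite mulr_ge0 //; first lra.
  rewrite addr_ge0 ?mulr_ge0 ?exprn_ge0 // ?invr_ge0 ?exprn_ge0 //.
  by rewrite addr_ge0 //; lra.
rewrite -{1}(size_iota k (2 * k)).
apply: (@count_has_le_const _ _ _ _ q).
  move=> m /asboolP[r' [z' [l1 l2 ne o' nr]]].
  have vr' : valid r' by case: o'.
  apply/hasP; exists (lvl r').
    by rewrite mem_iota l1 /= /k; clear -l2; lia.
  rewrite /q l1 l2 /=; apply/asboolP; exists (num r'); split=> //.
    (* A parallel road of the same level is at least [N >= 8 P] away in terms of [phi], too far to
       come near [r]. *)
    move=> el eb.
    have es : slope r' = slope r by rewrite /slope el eb.
    have h1 := near_line o' nr; rewrite es in h1.
    have [_ h2] := vertex_on R vr (i0 + m%:Z).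
    have {}h2 : `|phiz (slope r) (vertex r (i0 + m%:Z)) - lam R r| <= 1.
      by rewrite -(norm_sgM r) ger0_norm; lra.
    have offne : off r' <> off r.
      by move=> eo; apply: ne; exact: road_eq.
    have lamd : lvlN k <= `|lam R r - lam R r'|.
      have -> : lam R r - lam R r' = lvlN k * (off r - off r')%:~R.
        by rewrite /lam -el -/k intrB; ring.
      rewrite normrM (gtr0_norm (exprn_gt0 _ _)) //.
      apply: ler_peMr; first exact: exprn_ge0.
      rewrite -intr_norm ler1z; move: offne; clear; lia.
    have := lvlN_ge R k0; rewrite -/k in h1 P1.
    have := ler_distD (phiz (slope r) (vertex r (i0 + m%:Z))) (lam R r) (lam R r').
    rewrite (distrC (lam R r) (phiz _ _)) -/k => *.
    lra.
  apply/asboolP; exists (off r').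
  have := strip_point vr o' nr; rewrite intrD mulrDl addrA.
  by [].
move=> j; case: (boolP ((k <= j)%N && (2 * j < 5 * k)%N)) => hj; last first.
  rewrite (eq_count (a2 := pred0)); first by rewrite count_pred0.
  by move=> m; apply/negbTE; apply: contraNN hj => /and3P[-> ->].
have /andP[kj jk] := hj.
apply: le_trans (level_bound k0 kj jk (ler0n _ n) tau1).
pose b_of (e : nat) : int := e%:Z - 2 ^+ (40 * j).
pose q' (e : nat) (m : nat) := `[< [/\ valid (dirs j (b_of e)),
  (lvl r = j -> num r <> b_of e) & hit (dirs j (b_of e)) m] >].
have -> : 2 * lvlM j = (size (iota 0 (2 * 2 ^ (40 * j))))%:R.
  by rewrite size_iota natrM natrX.
apply: (@count_has_le_const _ _ _ _ q').
  move=> m /and3P[_ _ /asboolP[b [vb nb hb]]].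
  have bE : b_of (absz (b + 2 ^+ (40 * j))) = b.
    rewrite /b_of; case: vb => _ /=; move: (2 ^+ _ : int) => M; clear; lia.
  apply/hasP; exists (absz (b + 2 ^+ (40 * j))); last first.
    by apply/asboolP; rewrite bE.
  rewrite mem_iota /= add0n; case: vb => _ /=.
  have -> : 2 ^+ (40 * j) = (2 ^ (40 * j))%N%:Z :> int by rewrite -natz natrX.
  by move: (2 ^ _)%N => M; clear; lia.
move=> e.
have N0 : 0 < lvlN j by rewrite exprn_gt0.
have M0 : 0 < lvlM j by rewrite exprn_gt0.
case: (pselect (valid (dirs j (b_of e)) /\ (lvl r = j -> num r <> b_of e))) => [[vb nb]|no].
  have th1 := dt_ge R vr vb kj nb.
  have th2 := @dt_le1 R _ _ vr vb.
  have := count_strips (A (slope (dirs j (b_of e)))) n (le_trans ler01 tau1) M0 N0 th1 th2.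
  apply: le_trans; rewrite ler_nat; apply: sub_count => m /asboolP[_ _ /asboolP h].
  exact/asboolP.
rewrite (eq_count (a2 := pred0)); last first.
  by move=> m; apply/negbTE/asboolPn => -[vb nb _]; apply: no.
have nt : 0 <= 2 * (n%:R + tau) by have := ler0n R n; lra.
rewrite count_pred0 mulr_ge0 ?addr_ge0 ?divr_ge0 ?(ltW N0) //.
by rewrite !mulr_ge0 ?(ltW M0) //; lra.
Qed.

Lemma vertex_coord r i : valid r -> exists e : R, [/\ 0 <= e < 1,
  (vertex r i).1%:~R = - (sg r)%:~R * lam R r + i%:~R * (1 - `|slope r|) - e
  & (vertex r i).2%:~R = lam R r + i%:~R * slope r + (sg r)%:~R * e].
Proof.
move=> vr; have [_ o] := vertex_on R vr i.
have [] := track_coord R r (vertex r i); rewrite vertex_index.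
by set e := _ * (phiz _ _ - _) in o * => z1 z2; exists e.
Qed.

Lemma vertex_near k b c c' (i i' : int) : valid (Road k b c) ->
  near (`|lam R (Road k b c) - lam R (Road k b c')| + `|i%:~R - i'%:~R| + 1)
    (vertex (Road k b c) i) (vertex (Road k b c') i').
Proof.
move=> vr; have /andP[s0 s1] := slope_bounds R vr.
have [e [e01 z1 z2]] := vertex_coord i vr.
have [e' [e01' z1' z2']] := @vertex_coord (Road k b c') i' vr.
rewrite /near z1 z2 z1' z2'.
have -> : slope (Road k b c') = slope (Road k b c) by [].
have -> : sg (Road k b c') = sg (Road k b c) by [].
set g := sg _; set s := slope _ in s0 s1 *.
set l := lam R (Road k b c); set l' := lam R (Road k b c').
have de : `|e - e'| <= 1 by rewrite ler_norml; lra.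
have sgE (x : R) : `|g%:~R * x| = `|x| by exact: norm_sgM.
have tri (x y w : R) : `|x + y + w| <= `|x| + `|y| + `|w|.
  by apply: le_trans (ler_normD _ _) _; rewrite lerD2r ler_normD.
split.
- rewrite (_ : _ - _ = - (g%:~R * (l - l')) + (i%:~R - i'%:~R) * (1 - `|s|) + - (e - e')).
    apply: le_trans (tri _ _ _) _; rewrite !normrN sgE normrM.
    apply: lerD => //; apply: lerD => //; apply: ler_piMr => //.
    by rewrite ger0_norm; lra.
  by ring.
- rewrite (_ : _ - _ = (l - l') + (i%:~R - i'%:~R) * s + g%:~R * (e - e')).
    apply: le_trans (tri _ _ _) _; rewrite sgE normrM.
    apply: lerD => //; apply: lerD => //; apply: ler_piMr => //.
    exact: ltW.
  by ring.
Qed.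

Lemma near_trans (rho rho' : R) z z' z'' :
  near rho z z' -> near rho' z' z'' -> near (rho + rho') z z''.
Proof.
by move=> [a1 a2] [b1 b2]; split; apply: le_trans (ler_distD _ _ _) (lerD _ _);
  eassumption.
Qed.

Lemma near_le (rho rho' : R) z z' : rho <= rho' -> near rho z z' -> near rho' z z'.
Proof. by move=> h [a1 a2]; split; apply: le_trans h. Qed.

(* If the displacement [x] between points of two parallel roads is almost
   parallel to a third line of direction [v], then [x] is long: with [u] the
   direction of the roads, [phi_u x * v - phi_v x * u = det (u, v) * x]. *)
Lemma phi_cross (s s' x y : R) : `|s| <= 1 -> `|s'| <= 1 ->
  `|phi s x y| <= `|phi s' x y| + `|dt s' s| * (`|x| + `|y|).
Proof.
move=> s1 s1'.
have dirN (t : R) : `|t| <= 1 -> `|1 - `|t| | + `|t| = 1.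
  by move=> t1; rewrite ger0_norm; lra.
rewrite -[X in X <= _]mulr1 -(dirN _ s1') mulrDr -!normrM.
have e1 : phi s x y * (1 - `|s'|) = phi s' x y * (1 - `|s|) - dt s' s * x.
  by rewrite /dt /phi; ring.
have e2 : phi s x y * s' = phi s' x y * s - dt s' s * y.
  by rewrite /dt /phi; ring.
rewrite e1 e2; apply: le_trans (lerD (ler_normB _ _) (ler_normB _ _)) _.
rewrite !normrM.
have : `|phi s' x y| * (`|1 - `|s| | + `|s|) = `|phi s' x y| by rewrite dirN ?mulr1.
by lra.
Qed.

(* In a region smaller than [lvlP j], all active points of the levels [>= j] lie
   on one road [h]. If [h] spoils a long stretch of [r0] then it is almost
   parallel to [r0], and does not reach the next parallel road [r1]. *)
Lemma far_choice k b c (i0 : int) (n E : nat) : valid (Road k b c) ->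
  (forall j, (5 * k <= 2 * j)%N -> n%:R + lvlN k + 1 + 2 * lvlP k <= lvlP j) ->
  32 * lvlP k * (n%:R + lvlN k + 1) < lvlN k * E%:R ->
  (count (fun m : nat => far_bad (Road k b c) (i0 + m%:Z)) (iota 0 n) <= E.+1)%N \/
  (count (fun m : nat => far_bad (Road k b (c + 1)) (i0 + m%:Z)) (iota 0 n) <= E.+1)%N.
Proof.
move=> vr big large; set r0 := Road k b c; set r1 := Road k b (c + 1).
have vr1 : valid r1 by [].
pose p r m := (m < n)%N && far_bad r (i0 + m%:Z).
have pE r : count (fun m : nat => far_bad r (i0 + m%:Z)) (iota 0 n)
    = count (p r) (iota 0 n).
  by apply: eq_in_count => m; rewrite mem_iota /p /= => ->.
rewrite !pE.
have [h|h] := leqP (count (p r0) (iota 0 n)) E.+1; [by left | right].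
(* By [count_span], more than [E + 1] hits cannot all lie within [E] of each other. *)
have [m [m' [pm pm' mm']]] : exists m m', [/\ p r0 m, p r0 m' & (m + E < m')%N].
  apply: contrapT => no; move: h; rewrite ltnNge => /negP; apply.
  apply: count_span => m m' pm pm'; rewrite leqNgt; apply/negP => lt.
  by apply: no; exists m, m'.
case: (posnP (count (p r1) (iota 0 n))) => [->//|].
rewrite -has_count => /hasP[m3 _ pm3]; exfalso; clear h.
have lamd : lam R r1 - lam R r0 = lvlN k by rewrite /lam /= intrD; ring.
have P1 := lvlP_ge1 R k.
have N8 : 8 * lvlP k <= lvlN k := lvlN_ge R (lvl_gt0 vr).
(* The two points are within [n + N + 1 + 2 P] of each other, which by [big] is at most the radius
   of the lower of their levels, so [act_near] applies. *)
have same r r' x x' h h' z z' :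
    (r = r0 \/ r = r1) -> (r' = r0 \/ r' = r1) -> (x < n)%N -> (x' < n)%N ->
    (5 * k <= 2 * lvl h)%N -> (5 * k <= 2 * lvl h')%N -> act h z -> act h' z' ->
    near (lvlP k) (vertex r (i0 + x%:Z)) z -> near (lvlP k) (vertex r' (i0 + x'%:Z)) z' ->
    h = h'.
  move=> rE rE' xn xn' lh lh' ah ah' nz nz'.
  have ixn : `|(i0 + x%:Z)%:~R - (i0 + x'%:Z)%:~R| <= n%:R :> R.
    rewrite !intrD opprD addrACA subrr add0r ler_norml.
    have : x%:R <= n%:R :> R by rewrite ler_nat ltnW.
    have : x'%:R <= n%:R :> R by rewrite ler_nat ltnW.
    have := ler0n R x; have := ler0n R x'; rewrite -!pmulrn; lra.
  have nv : near (lvlN k + n%:R + 1) (vertex r (i0 + x%:Z)) (vertex r' (i0 + x'%:Z)).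
    have N0 : 0 <= lvlN k by lra.
    have Ld : `|lam R r - lam R r'| <= lvlN k.
      by case: rE rE' => -> [] ->; rewrite ?subrr ?normr0 ?(distrC (lam R r0)) ?lamd
        ?ger0_norm.
    by case: rE rE' Ld => -> [] -> Ld; apply: near_le (vertex_near _ _ _ _) => //;
      rewrite lerD2r lerD.
  have nn : near (n%:R + lvlN k + 1 + 2 * lvlP k) z z'.
    apply: near_le (near_trans (near_sym nz) (near_trans nv nz')); lra.
  case: (leqP (lvl h) (lvl h')) => hl; [|symmetry].
    by apply: act_near ah ah' hl (near_le _ nn); exact: big.
  by apply: act_near ah' ah (ltnW hl) (near_le _ (near_sym nn)); exact: big.
move: pm pm' pm3 => /andP[mn /asboolP[h [z [lh ah nz]]]].
move=> /andP[mn' /asboolP[h' [z' [lh' ah' nz']]]].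
move=> /andP[mn3 /asboolP[h3 [z3 [lh3 ah3 nz3]]]].
have e' : h = h'.
  by apply: (same r0 r0) nz nz' => //; left.
have e3 : h = h3.
  by apply: (same r0 r1) nz nz3 => //; [left | right].
subst h' h3.
have [oh _] := act_F ah; have [oh' _] := act_F ah'; have [oh3 _] := act_F ah3.
have vh : valid h by case: oh.
have d1 := strip_point vr oh nz; have d2 := strip_point vr oh' nz'.
rewrite /= -/r0 in d1 d2.
set th := dt (slope h) (slope r0) in d1 d2.
(* [h] is near [r0] at two vertices more than [E] indices apart, which bounds the angle between
   these roads. *)
have thE : `|th| * E%:R <= 2 * lvlP k + 4.
  have mE : E%:R <= m'%:R - m%:R :> R.
    by rewrite lerBrDr -natrD ler_nat addnC ltnW.
  apply: le_trans (_ : `|th| * (m'%:R - m%:R) <= _); first exact: ler_wpM2l.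
  have mm0 : 0 <= m'%:R - m%:R :> R by apply: le_trans mE.
  rewrite -(ger0_norm mm0) -normrM; move: d1 d2.
  set A := phi _ _ _; set L := lam R h.
  rewrite !intrD -!pmulrn => d1 d2.
  rewrite (_ : th * _ = (A + (i0%:~R + m'%:R) * th - L) - (A + (i0%:~R + m%:R) * th - L)).
    by apply: le_trans (ler_normB _ _) _; lra.
  by ring.
have f1 := near_line oh nz; have f3 := near_line oh3 nz3.
have [_ g1] := vertex_on R vr (i0 + m%:Z).
have [_ g3] := vertex_on R vr1 (i0 + m3%:Z).
rewrite -/r0 in g1; have sE : slope r1 = slope r0 by [].
have gE : sg r1 = sg r0 by [].
rewrite sE gE in g3.
(* Both staircases lie on the same side of their lines; centring the unit interval loses 1 / 2 for
   each, hence [N - 1] in [low]. *)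
have {}g1 : `|phiz (slope r0) (vertex r0 (i0 + m%:Z)) - lam R r0 - 1 / 2 * (sg r0)%:~R| <= 1 / 2.
  rewrite -(norm_sgM r0) mulrBr (mulrC (1 / 2)) sgM ler_norml; lra.
have {}g3 : `|phiz (slope r0) (vertex r1 (i0 + m3%:Z)) - lam R r1 - 1 / 2 * (sg r0)%:~R| <= 1 / 2.
  rewrite -(norm_sgM r0) mulrBr (mulrC (1 / 2)) sgM ler_norml; lra.
set v1 := vertex r0 (i0 + m%:Z) in g1 f1; set v3 := vertex r1 (i0 + m3%:Z) in g3 f3.
have [dx dy] : near (lvlN k + n%:R + 1) v1 v3.
  have ixn : `|(i0 + m%:Z)%:~R - (i0 + m3%:Z)%:~R| <= n%:R :> R.
    rewrite !intrD opprD addrACA subrr add0r ler_norml.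
    have : m%:R <= n%:R :> R by rewrite ler_nat ltnW.
    have : m3%:R <= n%:R :> R by rewrite ler_nat ltnW.
    have := ler0n R m; have := ler0n R m3; rewrite -!pmulrn; lra.
  apply: near_le (vertex_near _ _ _ _) => //; rewrite lerD2r lerD //.
  by rewrite -/r0 -/r1 distrC lamd ger0_norm //; lra.
have /andP[_ s1] := slope_bounds R vr; have /andP[_ s1'] := slope_bounds R vh.
have cross := phi_cross (v1.1%:~R - v3.1%:~R) (v1.2%:~R - v3.2%:~R) (ltW s1) (ltW s1').
have phiB (s : R) : phi s (v1.1%:~R - v3.1%:~R) (v1.2%:~R - v3.2%:~R)
    = phiz s v1 - phiz s v3 by rewrite /phiz /phi; ring.
rewrite !phiB -/r0 -/th in cross.
have low : lvlN k - 1 <= `|phiz (slope r0) v1 - phiz (slope r0) v3|.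
  rewrite ler_normr; apply/orP; right.
  by move: g1 g3; rewrite !ler_norml; lra.
have up : `|phiz (slope h) v1 - phiz (slope h) v3| <= 2 * lvlP k + 2.
  have := ler_normB (phiz (slope h) v1 - lam R h) (phiz (slope h) v3 - lam R h).
  rewrite (_ : _ - _ - _ = phiz (slope h) v1 - phiz (slope h) v3); last by ring.
  by move: f1 f3 => /= f1 f3; lra.
have len : `|v1.1%:~R - v3.1%:~R| + `|v1.2%:~R - v3.2%:~R| <= 2 * (n%:R + lvlN k + 1).
  by lra.
have W0 : 0 <= n%:R + lvlN k + 1 by rewrite !addr_ge0 // exprn_ge0.
exact: far_absurd P1 N8 (ler0n _ E) W0 (normr_ge0 th) thE low cross up len large.
Qed.

(** 20 is for the rounding in [time], [4 N + 2] bounds the lattice steps needed to reach the road,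
    and each inactive vertex costs 560. *)
Definition detour (k n E : nat) : R :=
  20 + 280 * (4 * lvlN k + 2) + 560 * (near_bad_bound k n.+1 + E.+1%:R).

Lemma leg_on r z (a : R) (i0 : int) (n E : nat) : valid r ->
  `|phiz (slope r) z - lam R r| <= 2 * lvlN (lvl r) ->
  n = Num.truncn `|a| -> i0 = (if 0 <= a then index r z else index r z - n%:Z) ->
  (count (fun m : nat => far_bad r (i0 + m%:Z)) (iota 0 n.+1) <= E.+1)%N ->
  exists z', [/\ creach z z' (60 * dnorm R r * `|a| + detour (lvl r) n E),
    `|z'.1%:~R - (z.1%:~R + a * (1 - `|slope r|))| <= 2 * lvlN (lvl r) + 2
    & `|z'.2%:~R - (z.2%:~R + a * slope r)| <= 2 * lvlN (lvl r) + 2].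
Proof.
move=> vr zr nE i0E far.
have /andP[s0 s1] := slope_bounds R vr.
have /andP[d0 d1] := dnorm_bounds R vr.
have [] := track_coord R r z; set ez := _ * (phiz _ _ - _); set i := index r z in i0E *.
move=> z1 z2.
have hez : `|ez| <= 2 * lvlN (lvl r) by rewrite norm_sgM.
have nle : n%:R <= `|a| by rewrite nE truncn_le.
have nlt : `|a| < n%:R + 1 by rewrite nE natr1 truncnS_gt.
pose i1 := if 0 <= a then i + n%:Z else i - n%:Z.
have i1a : `|i1%:~R - i%:~R - a| <= 1.
  rewrite /i1; move: nle nlt; case: (lerP 0 a) => ha; rewrite ?(ger0_norm ha) ?(ltr0_norm ha);
  rewrite ?intrB ?intrD -!pmulrn ler_norml; lra.
have cost : creach (vertex r i) (vertex r i1) (60 * dnorm R r * `|a| + 20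
    + 560 * (near_bad_bound (lvl r) n.+1 + E.+1%:R)).
  have tr : creach (vertex r i0) (vertex r (i0 + n%:Z)) (60 * dnorm R r * `|a| + 20
    + 560 * (near_bad_bound (lvl r) n.+1 + E.+1%:R)).
    apply: reach_le (road_travel i0 n vr).
    have cb := count_bad i0 n.+1 vr; have nb := count_near_bad i0 n.+1 vr.
    move: cb far; rewrite -!(ler_nat R) natrD => cb far.
    have /andP[t1 _] := time_close R r i0; have /andP[_ t2] := time_close R r (i0 + n%:Z).
    have tn : 60 * dnorm R r * n%:R <= 60 * dnorm R r * `|a|.
      by apply: ler_wpM2l => //; lra.
    move: t2; rewrite intrB intrD -pmulrn; lra.
  move: tr; rewrite i0E /i1; case: ifP => _ // tr.
  by apply: creach_sym; rewrite subrK in tr.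
have [e [e01 v1 v2]] := vertex_coord i vr.
have [e' [e01' w1 w2]] := vertex_coord i1 vr.
exists (vertex r i1); split.
- have st : creach z (vertex r i) (280 * (4 * lvlN (lvl r) + 2)).
    apply: creach_lattice; rewrite v1 v2 z1 z2.
    have he : `|e - ez| <= 2 * lvlN (lvl r) + 1.
      exact: normB_unit_le e01 hez.
    rewrite (_ : _ - _ - _ = e - ez); last by ring.
    rewrite (_ : _ + _ * ez - _ = - ((sg r)%:~R * (e - ez))); last by ring.
    by rewrite normrN norm_sgM; lra.
  by apply: reach_le (reach_trans st cost); rewrite /detour; lra.
- rewrite w1 z1 (_ : _ - _ = (i1%:~R - i%:~R - a) * (1 - `|slope r|) - (e' - ez)); last by ring.
  apply: le_trans (ler_normB _ _) _; rewrite normrM.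
  have h1 : `|i1%:~R - i%:~R - a| * `|1 - `|slope r| | <= 1.
    by rewrite mulr_ile1 //; rewrite ger0_norm; lra.
  have h2 : `|e' - ez| <= 2 * lvlN (lvl r) + 1.
    exact: normB_unit_le e01' hez.
  by lra.
- rewrite w2 z2 (_ : _ - _ = (i1%:~R - i%:~R - a) * slope r + (sg r)%:~R * (e' - ez)); last by ring.
  apply: le_trans (ler_normD _ _) _; rewrite normrM norm_sgM.
  have h1 : `|i1%:~R - i%:~R - a| * `|slope r| <= 1 by rewrite mulr_ile1 // ltW.
  have h2 : `|e' - ez| <= 2 * lvlN (lvl r) + 1.
    exact: normB_unit_le e01' hez.
  by lra.
Qed.

(** [far_choice] is offered the road below [z] with offset the integer part of [x] and the next one.
    In terms of [phi] both are within [3 / 2 * N] of [z], and one of them loses few vertices. *)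
Lemma leg k b z (a : R) (n E : nat) : valid (Road k b 0) -> n = Num.truncn `|a| ->
  (forall j, (5 * k <= 2 * j)%N -> n.+1%:R + lvlN k + 1 + 2 * lvlP k <= lvlP j) ->
  32 * lvlP k * (n.+1%:R + lvlN k + 1) < lvlN k * E%:R ->
  let r := Road k b 0 in
  exists z', [/\ creach z z' (60 * dnorm R r * `|a| + detour k n E),
    `|z'.1%:~R - (z.1%:~R + a * (1 - `|slope r|))| <= 2 * lvlN k + 2
    & `|z'.2%:~R - (z.2%:~R + a * slope r)| <= 2 * lvlN k + 2].
Proof.
move=> vr nE big large r.
have N0 : 0 < lvlN k by rewrite exprn_gt0.
pose x := phiz (slope r) z / lvlN k.
pose i0 := if 0 <= a then index r z else index r z - n%:Z.
have xE : phiz (slope r) z = lvlN k * x by rewrite /x mulrC divfK ?gt_eqF.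
have f1 := floor_le x; have f2 := floorD1_gt x; rewrite intrD in f2.
have L0 : `|phiz (slope r) z - lam R (Road k b (Num.floor x))| <= 2 * lvlN k.
  rewrite xE /lam /= -mulrBr normrM (gtr0_norm N0) [2 * _]mulrC ler_pM2l //.
  by rewrite ler_norml; lra.
have L1 : `|phiz (slope r) z - lam R (Road k b (Num.floor x + 1))| <= 2 * lvlN k.
  rewrite xE /lam /= intrD -mulrBr normrM (gtr0_norm N0) [2 * _]mulrC ler_pM2l //.
  by rewrite ler_norml; lra.
case: (@far_choice k b (Num.floor x) i0 n.+1 E vr big large) => far.
- by apply: (@leg_on (Road k b (Num.floor x)) z a i0 n E).
- by apply: (@leg_on (Road k b (Num.floor x + 1)) z a i0 n E).
Qed.

End Travel.

(** * Decomposition along two directions *)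

Section Cone.
Variable R : realType.

Lemma valid_opp k b c : valid (Road k b c) -> valid (Road k (- b) c).
Proof. by case=> /= h1 h2; split=> /=; [clear -h1; lia | rewrite normrN]. Qed.

(** The direction of [(X, Y)] is encoded by [T = M * Y / (X + Y)], to be placed between consecutive
    odd integers. No road is parallel to an axis, so near an axis one of the two directions lies
    beyond it; beyond the vertical one, this is a road traversed backwards, [e = -1]. *)
Lemma cone_quadrant k (X Y : R) : (0 < k)%N -> 0 <= X -> 0 <= Y ->
  exists b b' : int, exists e al be : R,
  let s := slope R (Road k b 0) in let s' := slope R (Road k b' 0) in
  [/\ valid (Road k b 0), valid (Road k b' 0), e = 1 \/ e = -1,
      [/\ 0 <= al, 0 <= be & al + be <= 2 * (X + Y)] &
      [/\ X = al * (1 - `|s|) + be * (e * (1 - `|s'|)), Y = al * s + be * (e * s'),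
         0 <= (1 - `|s|) * (e * (1 - `|s'|)) + s * (e * s') &
         `|(1 - `|s|) * (e * s') - s * (e * (1 - `|s'|))| <= 2 / lvlM R k]].
Proof.
move=> k0 X0 Y0.
pose Mi : int := 2 ^+ (40 * k).
have [h [MiE Mi4]] : exists h : int, Mi = 2 * h /\ 4 <= Mi.
  exists (2 ^+ (40 * k).-1); split.
    by rewrite /Mi -exprS; congr (_ ^+ _); clear -k0; lia.
  apply: (@le_trans _ _ (2 ^+ 2)) => //.
  by rewrite /Mi ler_weXn2l //; clear -k0; lia.
have val (g : int) : `|2 * g + 1| < Mi -> valid (Road k (2 * g + 1) 0).
  by move=> bM; split=> //=; clear; lia.
have slE (b : int) : slope R (Road k b 0) = b%:~R / Mi%:~R.
  by rewrite /slope lvlM_int.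
have MR : (Mi%:~R : R) = 2 * h%:~R by rewrite MiE intrM.
have M4 : 4 <= Mi%:~R :> R by rewrite (ler_int R 4).
rewrite lvlM_int -/Mi; set M : R := Mi%:~R in slE MR M4 *.
have ME : Mi%:~R = M by [].
clearbody M; have M0 : 0 < M by lra.
set i := M^-1.
have i0 : 0 < i by rewrite invr_gt0.
have Mi1 : M * i = 1 by rewrite divff ?gt_eqF.
have i4 : i <= 1 / 4 by nra.
set c := (1 - i)^-1.
have ci : c * (1 - i) = 1 by rewrite mulVf ?gt_eqF //; lra.
have c2 : c <= 2 by nra.
have c1 : 0 < c by nra.
clearbody c.
(* The case [T < 1] comes first, with slopes [- 1 / M] and [1 / M]; then [T >= M - 1], which
   includes [X = Y = 0]. *)
have [hB|hB] := lerP (X + Y) (M * Y); last first.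
  exists (-1), 1, 1, ((c * X - M * Y) / 2), ((c * X + M * Y) / 2).
  have YX : M * Y <= c * X.
    have : (1 - i) * (M * Y) <= X by nra.
    by move=> q; nra.
  have sE : slope R (Road k (-1) 0) = - i by rewrite slE rmorphN1 mulN1r.
  have sE' : slope R (Road k 1 0) = i by rewrite slE mul1r.
  rewrite /= sE sE' normrN (ger0_norm (ltW i0)) !mul1r.
  split; [| | by left | split | split].
  - by apply: (val (-1)); clear -Mi4; lia.
  - by apply: (val 0); clear -Mi4; lia.
  - by nra.
  - by nra.
  - by nra.
  - by have /= := congr1 (fun t => t * X) ci; lra.
  - by have /= := congr1 (fun t => t * Y) Mi1; lra.
  - by nra.
  - by rewrite ler_norml; nra.
have [hC|hC] := lerP (M * X) (X + Y).
  pose g := h - 1; have gE : 2 * g + 1 = Mi - 1 by rewrite /g MiE; ring.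
  have sE : slope R (Road k (2 * g + 1) 0) = 1 - i.
    by rewrite slE gE intrB ME mulrBl divff ?gt_eqF // mul1r.
  have sE' : slope R (Road k (2 * (- h) + 1) 0) = - (1 - i).
    rewrite slE (_ : 2 * - h + 1 = - (Mi - 1)); last by rewrite MiE; ring.
    by rewrite mulrNz mulNr intrB ME mulrBl divff ?gt_eqF // mul1r.
  exists (2 * g + 1), (2 * (- h) + 1), (-1), ((c * Y + M * X) / 2), ((c * Y - M * X) / 2).
  have XY : M * X <= c * Y.
    have : (1 - i) * (M * X) <= Y by nra.
    by move=> q; nra.
  rewrite /= sE sE' normrN (ger0_norm (_ : 0 <= 1 - i)); last lra.
  split; [| | by right | split | split].
  - by apply: val; rewrite gE; clear -Mi4; lia.
  - by apply: val; clear -Mi4 MiE; lia.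
  - by nra.
  - by nra.
  - by nra.
  - by have /= := congr1 (fun t => t * X) Mi1; lra.
  - by have /= := congr1 (fun t => t * Y) ci; lra.
  - by nra.
  - by rewrite ler_norml; nra.
have n0 : 0 < X + Y by nra.
pose T := M * Y / (X + Y).
have TE : T * (X + Y) = M * Y by rewrite /T divfK ?gt_eqF.
have T1 : 1 <= T by rewrite /T ler_pdivlMr // mul1r.
have T2 : T < M - 1 by rewrite /T ltr_pdivrMr //; nra.
pose g := Num.floor ((T - 1) / 2).
have g1 := floor_le ((T - 1) / 2); have g2 := floorD1_gt ((T - 1) / 2).
rewrite -/g in g1 g2; rewrite intrD in g2.
have g0 : 0 <= g by rewrite /g floor_ge0; lra.
have gh : g <= h - 2.
  rewrite -ltzD1 -(ltr_int R) !intrD rmorphN /=; lra.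
have sE : slope R (Road k (2 * g + 1) 0) = (2 * g%:~R + 1) * i.
  by rewrite slE intrD intrM.
have sE' : slope R (Road k (2 * (g + 1) + 1) 0) = (2 * g%:~R + 3) * i.
  by rewrite slE intrD intrM intrD; congr (_ * _); ring.
have gR : 0 <= g%:~R :> R by rewrite ler0z.
have ghR : g%:~R <= h%:~R - 2 :> R by move: gh; rewrite -(ler_int R) intrB.
exists (2 * g + 1), (2 * (g + 1) + 1), 1,
  ((X + Y) * (2 * g%:~R + 3 - T) / 2), ((X + Y) * (T - (2 * g%:~R + 1)) / 2).
rewrite /= sE sE' !mul1r.
set B : R := g%:~R in g1 g2 gR ghR sE sE' *.
have u0 : 0 <= (2 * B + 1) * i by nra.
have u1 : 0 <= (2 * B + 3) * i by nra.
have u2 : (2 * B + 3) * i <= 1 by nra.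
have u3 : (2 * B + 1) * i <= 1 by nra.
rewrite (ger0_norm u0) (ger0_norm u1).
split; [| | by left | split | split].
- by apply: val; clear -gh g0 MiE; lia.
- by apply: val; clear -gh g0 MiE; lia.
- by nra.
- by nra.
- by nra.
- have /= := congr1 (fun t => t * i) TE; have /= := congr1 (fun t => t * Y) Mi1; lra.
- have /= := congr1 (fun t => t * i) TE; have /= := congr1 (fun t => t * Y) Mi1; lra.
- by rewrite addr_ge0 // mulr_ge0 // subr_ge0.
- rewrite (_ : _ - _ = 2 * i); last by ring.
  by rewrite ger0_norm; lra.
Qed.

Lemma abs_split (X : R) : exists t : int, [/\ t = 1 \/ t = -1 & X = t%:~R * `|X|].
Proof.
case: (lerP 0 X) => h; [exists 1|exists (-1)]; split.
- by left.
- by rewrite mul1r ger0_norm.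
- by right.
- by rewrite ltr0_norm // mulN1r opprK.
Qed.

(** Reflections in the axes reduce this to the quadrant: slopes are multiplied by [tx * ty], and
    [tx] tells which way the roads are traversed. *)
Lemma cone k (X Y : R) : (0 < k)%N ->
  exists b b' : int, exists al be : R,
  let r := Road k b 0 in let r' := Road k b' 0 in
  [/\ valid r, valid r',
     X = al * (1 - `|slope R r|) + be * (1 - `|slope R r'|) /\
     Y = al * slope R r + be * slope R r',
     `|al| + `|be| <= 2 * (`|X| + `|Y|)
   & dnorm R r * `|al| + dnorm R r' * `|be|
     <= enorm X Y + 32 * (`|X| + `|Y|) / lvlM R k ^+ 2].
Proof.
move=> k0.
have [b [b' [e [al [be [vr vr' e1 [al0 be0 albe] [XE YE dot0 det]]]]]]] :=
  cone_quadrant k0 (normr_ge0 X) (normr_ge0 Y).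
have [tx [tx1 Xt]] := abs_split X; have [ty [ty1 Yt]] := abs_split Y.
have t1 : tx * ty = 1 \/ tx * ty = -1.
  by case: tx1 ty1 => -> [] ->; [left | right | right | left].
have slt (c : int) : slope R (Road k (tx * ty * c) 0)
    = (tx * ty)%:~R * slope R (Road k c 0) by rewrite /slope /= intrM mulrA.
have vt (c : int) : valid (Road k c 0) -> valid (Road k (tx * ty * c) 0).
  by case: t1 => ->; rewrite ?mul1r ?mulN1r // => /valid_opp.
have nt (x : R) : `|(tx * ty)%:~R * x| = `|x|.
  by case: t1 => ->; rewrite ?mul1r ?mulN1r ?normrN.
have tx2 : tx%:~R * tx%:~R = 1 :> R by case: tx1 => ->; rewrite ?mulrNN mulr1.
have ntx (x : R) : `|tx%:~R * x| = `|x|.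
  by case: tx1 => ->; rewrite ?mul1r ?mulN1r ?normrN.
have ne (x : R) : `|e * x| = `|x|.
  by case: e1 => ->; rewrite ?mul1r ?mulN1r ?normrN.
have dnt (c : int) : dnorm R (Road k (tx * ty * c) 0) = dnorm R (Road k c 0).
  rewrite /dnorm slt nt /enorm exprMn; congr (Num.sqrt (_ + _)).
  by case: t1 => ->; rewrite ?rmorphN1 ?sqrrN expr1n mul1r.
exists (tx * ty * b), (tx * ty * b'), (tx%:~R * al), (tx%:~R * (e * be)).
split; [exact: vt | exact: vt | | | ].
- rewrite !slt !nt; split; first by rewrite {1}Xt XE; ring.
  rewrite {1}Yt YE intrM; move: tx2; set a : R := tx%:~R => a2.
  have := congr1 (fun x => x * (ty%:~R * (al * slope R (Road k b 0)
    + e * be * slope R (Road k b' 0)))) a2 => /=; lra.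
- by rewrite !ntx ne (ger0_norm al0) (ger0_norm be0).
- rewrite !ntx ne !dnt (ger0_norm al0) (ger0_norm be0).
  set r := Road k b 0 in XE YE dot0 det vr *; set r' := Road k b' 0 in XE YE dot0 det vr' *.
  have /andP[d1 _] := dnorm_bounds R vr; have /andP[d2 _] := dnorm_bounds R vr'.
  have ev : enorm (e * (1 - `|slope R r'|)) (e * slope R r') = dnorm R r'.
    by rewrite enormZ; case: e1 => ->; rewrite ?normrN normr1 mul1r.
  have := enorm_cone al0 be0 (_ : 1 <= 2 * enorm (1 - `|slope R r|) (slope R r))
     (_ : 1 <= 2 * enorm (e * (1 - `|slope R r'|)) (e * slope R r')) dot0 det.
  rewrite ev -/(dnorm R r) -XE -YE => h.
  have exy : enorm `|X| `|Y| = enorm X Y.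
    by rewrite /enorm !real_normK ?num_real.
  rewrite exy in h.
  have h1 : 1 <= 2 * dnorm R r by lra.
  have h2 : 1 <= 2 * dnorm R r' by lra.
  have {}h := h h1 h2.
  have M0 : 0 < lvlM R k by rewrite exprn_gt0.
  have -> : 32 * (`|X| + `|Y|) / lvlM R k ^+ 2
    = 4 * (2 * (`|X| + `|Y|)) * (2 / lvlM R k) ^+ 2.
    by field; rewrite gt_eqF.
  have : 4 * (al + be) * (2 / lvlM R k) ^+ 2
    <= 4 * (2 * (`|X| + `|Y|)) * (2 / lvlM R k) ^+ 2.
    by apply: ler_wpM2r; [exact: sqr_ge0 | rewrite ler_pM2l].
  by lra.
Qed.

End Cone.

(** * Length of a trip *)

Section Estimates.
Variable R : realType.

Local Notation lvlM := (lvlM R).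
Local Notation lvlN := (lvlN R).
Local Notation lvlP := (lvlP R).

Lemma detour_le k (n n' E : nat) : (n <= n')%N -> detour R k n E <= detour R k n' E.
Proof.
move=> nn; rewrite /detour /near_bad_bound.
have P1 := lvlP_ge1 R k.
have nR : n.+1%:R <= n'.+1%:R :> R by rewrite ler_nat.
have T0 : 0 < 2 ^+ (280 * k) :> R by rewrite exprn_gt0.
rewrite lerD2l; apply: ler_wpM2l; first exact: ler0n.
rewrite lerD2r; apply: ler_wpM2l; first exact: ler0n.
apply: ler_wpM2l; first by lra.
by rewrite lerD2r ler_pM2r ?invr_gt0 // ler_pM2l // lerD2r.
Qed.

Lemma detour_estimate k (y Q : R) (n0 E : nat) : 1 <= Q ->
  let t : R := 2 ^+ k in
  t ^+ 78 <= y -> y <= Q * t ^+ 78 -> n0%:R <= 2 * y ^+ 6 + 1 ->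
  E%:R <= 32 * lvlP k * (n0.+1%:R + lvlN k + 1) / lvlN k + 1 ->
  t * detour R k n0 E <= (1700 + 560 * (768 * Q + 110)) * y ^+ 5.
Proof.
move=> Q1 t ty yt n0y Ele.
have t1 : 1 <= t by apply: exprn_ege1; rewrite ler1n.
have t0 : 0 < t by lra.
have tX m : 0 < t ^+ m by rewrite exprn_gt0.
have tX1 m : 1 <= t ^+ m by rewrite exprn_ege1.
have tle m m' : (m <= m')%N -> t ^+ m <= t ^+ m' by move=> h; rewrite ler_weXn2l.
have kt : k%:R <= t by rewrite /t -natrX ler_nat ltnW // ltn_expl.
have NE : lvlN k = t ^+ 360 by rewrite /t -exprM mulnC.
have PE : lvlP k = t ^+ 188 by rewrite /t -exprM mulnC.
have E280 : 2 ^+ (280 * k) = t ^+ 280 by rewrite /t -exprM mulnC.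
have E200 : 2 ^+ (200 * k) = t ^+ 200 by rewrite /t -exprM mulnC.
clearbody t.
have y0 : 0 < y by apply: lt_le_trans (tX 78%N) ty.
have y5 : t ^+ 390 <= y ^+ 5.
  by rewrite (exprM t 78 5) ler_pXn2r // nnegrE ltW.
have y6 : t ^+ 468 <= y ^+ 6.
  by rewrite (exprM t 78 6) ler_pXn2r // nnegrE ltW.
have y50 : 0 < y ^+ 5 by rewrite exprn_gt0.
have div m : (78 <= m)%N -> y ^+ 6 / t ^+ m <= Q * y ^+ 5.
  move=> hm; rewrite ler_pdivrMr // [y ^+ 6]exprS [Q * _ * _]mulrAC.
  rewrite ler_pM2r //; apply: le_trans yt _; rewrite ler_pM2l; [exact: tle | lra].
rewrite /detour /near_bad_bound NE PE E280 E200.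
rewrite PE NE in Ele.
set NB := _ * (6 * _ * _).
have tNB : t * NB <= (576 * Q + 108) * y ^+ 5.
  have tau3 : t ^+ 188 + 2 <= 3 * t ^+ 188 by clear -tX1; have := tX1 188%N; lra.
  have n8 : n0.+1%:R + (t ^+ 188 + 2) <= 8 * y ^+ 6.
    clear -n0y tle tX1 y6; rewrite -natr1.
    by have := tle 188%N 468%N isT; have := tX1 188%N; lra.
  have i280 : 0 <= (t ^+ 280)^-1 by rewrite invr_ge0 ltW.
  have b1 : 2 * (n0.+1%:R + (t ^+ 188 + 2)) / t ^+ 280 + 3 * t ^+ 200
      <= 16 * y ^+ 6 / t ^+ 280 + 3 * t ^+ 200.
    by rewrite lerD2r; apply: ler_wpM2r => //; clear -n8; lra.
  have b10 : 0 <= 2 * (n0.+1%:R + (t ^+ 188 + 2)) / t ^+ 280 + 3 * t ^+ 200.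
    apply: addr_ge0; last by clear -tX; have := tX 200%N; lra.
    apply: divr_ge0; last exact: ltW.
    by clear -tX; have := ler0n R n0.+1; have := tX 188%N; lra.
  (* The number of levels costs one factor [t]. With the [t] in front, the exponent 1 + 1 + 188 +
     200 is exactly the 390 available. *)
  have kk : (2 * k)%:R <= 2 * t by clear -kt; rewrite natrM; lra.
  have NBle : NB <= 2 * t * (6 * (3 * t ^+ 188) * (16 * y ^+ 6 / t ^+ 280 + 3 * t ^+ 200)).
    have p188 := tX1 188%N.
    apply: ler_pM; [exact: ler0n | | exact: kk | ].
      by apply: mulr_ge0; [clear -p188; lra | exact: b10].
    by apply: ler_pM; [clear -p188; lra | exact: b10 | clear -tau3; lra | exact: b1].
  apply: le_trans (ler_wpM2l (ltW t0) NBle) _.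
  have -> : t * (2 * t * (6 * (3 * t ^+ 188) * (16 * y ^+ 6 / t ^+ 280 + 3 * t ^+ 200)))
      = 576 * (y ^+ 6 / t ^+ 90) + 108 * t ^+ 390.
    have e280 : t ^+ 280 = t ^+ 90 * t ^+ 190 by rewrite -exprD.
    have e190 : t ^+ 190 = t * t * t ^+ 188 by rewrite -expr2 -exprD.
    have e390 : t ^+ 390 = t ^+ 190 * t ^+ 200 by rewrite -exprD.
    rewrite e390 e280 e190; move: (t ^+ 188) (t ^+ 90) (t ^+ 200) (y ^+ 6) (tX 188%N) (tX 90%N).
    by move=> A B C D A0 B0; field; rewrite !gt_eqF.
  by have := div 90%N isT; clear -y5; lra.
have tE : t * E.+1%:R <= (192 * Q + 2) * y ^+ 5.
  have n6 : n0.+1%:R + t ^+ 360 + 1 <= 6 * y ^+ 6.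
    clear -n0y tle tX1 y6; rewrite -natr1.
    by have := tle 360%N 468%N isT; have := tX1 468%N; lra.
  have E2 : E.+1%:R <= 192 * (y ^+ 6 * t ^+ 188 / t ^+ 360) + 2.
    rewrite -natr1.
    suff : 32 * t ^+ 188 * (n0.+1%:R + t ^+ 360 + 1) / t ^+ 360
       <= 192 * (y ^+ 6 * t ^+ 188 / t ^+ 360) by clear -Ele; lra.
    rewrite (_ : 192 * _ = 32 * t ^+ 188 * (6 * y ^+ 6) / t ^+ 360).
      rewrite ler_pM2r ?invr_gt0 //; apply: ler_wpM2l => //.
      by rewrite mulr_ge0 // ltW.
    by move: (t ^+ 360)^-1 (t ^+ 188) (y ^+ 6) => A B C; ring.
  apply: le_trans (ler_wpM2l (ltW t0) E2) _.
  have -> : t * (192 * (y ^+ 6 * t ^+ 188 / t ^+ 360) + 2)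
      = 192 * (y ^+ 6 / t ^+ 171) + 2 * t.
    have e360 : t ^+ 360 = t ^+ 171 * (t * t ^+ 188) by rewrite -exprS -exprD.
    rewrite e360; move: (t ^+ 188) (t ^+ 171) (y ^+ 6) (tX 188%N) (tX 171%N).
    by move=> A B C A0 B0; field; rewrite !gt_eqF.
  by have := div 171%N isT; have := tle 1%N 390%N isT; clear -y5; rewrite expr1; lra.
have tN : t * t ^+ 360 <= y ^+ 5 by rewrite -exprS; apply: le_trans y5; exact: tle.
have tle5 : t <= y ^+ 5 by apply: le_trans y5; exact: (tle 1%N).
by clear -tNB tE tN tle5; lra.
Qed.

Lemma error_total (A B D Y5 XY q c t : R) : 0 < t -> 0 < Y5 ->
  t * A <= q * Y5 -> t * B <= c * Y5 ->
  t * D <= Y5 -> t <= Y5 ->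
  60 * XY + 1920 * A + 2 * B + 1120 * (2 * D + 2)
  <= 60 * XY + (1040 + 1920 * q + 2 * c + 4480) * (Y5 / t).
Proof.
move=> t0 y0 tA tB tD tY.
have add4 (x y z w v : R) : y + z + w <= v -> x + y + z + w <= x + v by lra.
apply: add4; rewrite mulrA ler_pdivlMr //.
have : 0 <= 1040 * Y5 by rewrite mulr_ge0 ?ler0n // ltW.
have := ler_wpM2l (ler0n R 1920) tA; have := ler_wpM2l (ler0n R 1120) tD.
have := ler_wpM2l (ler0n R 1120) tY.
by move: tB; clear; lra.
Qed.

End Estimates.

Section Trip.
Variable R : realType.
Variable cr : int * int -> int * int -> R -> Prop.
Hypothesis cr_le : forall z z' c c', c <= c' -> cr z z' c -> cr z z' c'.
Hypothesis cr_trans : forall z z' z'' c c',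
  cr z z' c -> cr z' z'' c' -> cr z z'' (c + c').
Hypothesis cr_lattice : forall z z' (c : R),
  `|z.1%:~R - z'.1%:~R| + `|z.2%:~R - z'.2%:~R| <= c -> cr z z' (280 * c).
Hypothesis cr_leg : forall k b z (a : R) (n E : nat),
  valid (Road k b 0) -> n = Num.truncn `|a| ->
  (forall j, (5 * k <= 2 * j)%N ->
     n.+1%:R + lvlN R k + 1 + 2 * lvlP R k <= lvlP R j) ->
  32 * lvlP R k * (n.+1%:R + lvlN R k + 1) < lvlN R k * E%:R ->
  let r := Road k b 0 in
  exists z', [/\ cr z z' (60 * dnorm R r * `|a| + detour R k n E),
    `|z'.1%:~R - (z.1%:~R + a * (1 - `|slope R r|))| <= 2 * lvlN R k + 2
    & `|z'.2%:~R - (z.2%:~R + a * slope R r)| <= 2 * lvlN R k + 2].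

Local Notation lvlM := (lvlM R).
Local Notation lvlN := (lvlN R).
Local Notation lvlP := (lvlP R).

Lemma trip k z z' (n0 E : nat) : (0 < k)%N ->
  let X : R := z'.1%:~R - z.1%:~R in let Y : R := z'.2%:~R - z.2%:~R in
  2 * (`|X| + `|Y|) <= n0%:R ->
  (forall j, (5 * k <= 2 * j)%N -> n0.+1%:R + lvlN k + 1 + 2 * lvlP k <= lvlP j) ->
  32 * lvlP k * (n0.+1%:R + lvlN k + 1) < lvlN k * E%:R ->
  cr z z' (60 * enorm X Y + 1920 * (`|X| + `|Y|) / lvlM k ^+ 2
           + 2 * detour R k n0 E + 1120 * (2 * lvlN k + 2)).
Proof.
move=> k0 X Y XYn big large.
have [b [b' [al [be [vr vr' [XE YE] albe len]]]]] := cone X Y k0.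
have P0 : 0 < lvlP k by rewrite exprn_gt0.
have step (c : int) w (a : R) : valid (Road k c 0) -> `|a| <= n0%:R ->
    exists w', [/\ cr w w' (60 * dnorm R (Road k c 0) * `|a| + detour R k n0 E),
    `|w'.1%:~R - (w.1%:~R + a * (1 - `|slope R (Road k c 0)|))| <= 2 * lvlN k + 2
    & `|w'.2%:~R - (w.2%:~R + a * slope R (Road k c 0))| <= 2 * lvlN k + 2].
  move=> vc an.
  have nn : (Num.truncn `|a| <= n0)%N by rewrite truncn_le_nat; lra.
  have nR : (Num.truncn `|a|).+1%:R <= n0.+1%:R :> R by rewrite ler_nat.
  have [|| w' [h1 h2 h3]] := @cr_leg k c w a (Num.truncn `|a|) E vc erefl.
  - by move=> j /big; lra.
  - by apply: le_lt_trans large; rewrite ler_pM2l ?lerD2r //; lra.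
  exists w'; split=> //; apply: cr_le h1; rewrite lerD2l; exact: detour_le.
have := normr_ge0 al; have := normr_ge0 be => be0 al0.
have [z1 [c1 x1 y1]] := step b z al vr ltac:(lra).
have [z2 [c2 x2 y2]] := step b' z1 be vr' ltac:(lra).
(* Each leg errs by at most [2 N + 2] in each coordinate, and lattice steps make up for the sum. *)
have c3 : cr z2 z' (280 * (4 * (2 * lvlN k + 2))).
  apply: cr_lattice.
  have hx : `|z2.1%:~R - z'.1%:~R| <= 2 * (2 * lvlN k + 2).
    rewrite (_ : z'.1%:~R = z.1%:~R + X); last by rewrite /X addrC subrK.
    by move: x1 x2; rewrite XE !ler_norml; lra.
  have hy : `|z2.2%:~R - z'.2%:~R| <= 2 * (2 * lvlN k + 2).
    rewrite (_ : z'.2%:~R = z.2%:~R + Y); last by rewrite /Y addrC subrK.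
    by move: y1 y2; rewrite YE !ler_norml; lra.
  by lra.
apply: cr_le (cr_trans c1 (cr_trans c2 c3)); lra.
Qed.

(** [1040 <= C] serves to absorb the bounded losses at the end: 400 at either end by [reach_coarse]
    and 240 by [grid_pt_coarse]. *)
Lemma trip_estimate : exists C : R, 1040 <= C /\
  forall k z z' (y : R), (236 <= k)%N ->
    let t : R := 2 ^+ k in
    let X : R := z'.1%:~R - z.1%:~R in let Y : R := z'.2%:~R - z.2%:~R in
    t ^+ 78 <= y -> y <= 2 ^+ 78 * t ^+ 78 -> `|X| + `|Y| <= y ^+ 6 ->
    cr z z' (60 * enorm X Y + C * (y ^+ 5 / t)).
Proof.
pose Q : R := 2 ^+ 78.
have Q1 : 1 <= Q by apply: exprn_ege1; rewrite ler1n.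
exists (1040 + 1920 * Q + 2 * (1700 + 560 * (768 * Q + 110)) + 4480).
split; first by lra.
move=> k z z' y k236 t X Y ty yt XY6; rewrite -/Q in yt *.
have k0 : (0 < k)%N by apply: leq_trans k236.
have t1 : 1 <= t by apply: exprn_ege1; rewrite ler1n.
have t0 : 0 < t by lra.
have tX m : 0 < t ^+ m by rewrite exprn_gt0.
have tX1 m : 1 <= t ^+ m by rewrite exprn_ege1.
have tle m m' : (m <= m')%N -> t ^+ m <= t ^+ m' by move=> h; rewrite ler_weXn2l.
have NE : lvlN k = t ^+ 360 by rewrite /t -exprM mulnC.
have PE : lvlP k = t ^+ 188 by rewrite /t -exprM mulnC.
have ME : lvlM k = t ^+ 40 by rewrite /t -exprM mulnC.
have y0 : 0 < y by apply: lt_le_trans (tX 78%N) ty.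
have y5 : t ^+ 390 <= y ^+ 5.
  by rewrite (exprM t 78 5) ler_pXn2r // nnegrE ltW.
have y6 : t ^+ 468 <= y ^+ 6.
  by rewrite (exprM t 78 6) ler_pXn2r // nnegrE ltW.
have y50 : 0 < y ^+ 5 by rewrite exprn_gt0.
have y6Q : y ^+ 6 <= Q ^+ 6 * t ^+ 468.
  rewrite (exprM t 78 6) -exprMn ler_pXn2r // nnegrE ltW //.
  by rewrite mulr_gt0 //; lra.
set L := `|X| + `|Y| in XY6 *.
have L0 : 0 <= L by rewrite addr_ge0.
pose n0 := (Num.truncn (2 * L)).+1.
have n0L : 2 * L <= n0%:R by rewrite ltW // truncnS_gt.
have n0y : n0%:R <= 2 * y ^+ 6 + 1.
  have : (Num.truncn (2 * L))%:R <= 2 * L by rewrite truncn_le; lra.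
  by rewrite /n0 -natr1; lra.
pose x := 32 * lvlP k * (n0.+1%:R + lvlN k + 1) / lvlN k.
have x0 : 0 <= x.
  rewrite /x NE PE; apply: divr_ge0; last exact: ltW.
  apply: mulr_ge0; first by apply: mulr_ge0; [exact: ler0n | exact: ltW].
  by have := ler0n R n0.+1; have := tX 360%N; lra.
pose E := (Num.truncn x).+1.
have Ele : E%:R <= x + 1 by rewrite /E -natr1 lerD2r truncn_le.
have large : 32 * lvlP k * (n0.+1%:R + lvlN k + 1) < lvlN k * E%:R.
  rewrite [lvlN k * _]mulrC -ltr_pdivrMr; first exact: truncnS_gt.
  by rewrite NE.
have big j : (5 * k <= 2 * j)%N -> n0.+1%:R + lvlN k + 1 + 2 * lvlP k <= lvlP j.
  move=> kj.
  have P470 : t ^+ 470 <= lvlP j.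
    by rewrite /t /lvlP -exprM ler_weXn2l ?ler1n //; clear -kj; lia.
  have h8 : n0.+1%:R + lvlN k + 1 + 2 * lvlP k <= 8 * y ^+ 6.
    rewrite NE PE -natr1.
    have := tle 360%N 468%N isT; have := tle 188%N 468%N isT; have := tX1 468%N.
    by clear -n0y y6; lra.
  (* The origin of 236: [8 * Q ^ 6 = 2 ^ 471] must not exceed [2 ^ (2 k)]. The two spare powers of
     [t] are 188 * 5 / 2 = 470 against 468. *)
  have t2 : 8 * Q ^+ 6 <= t ^+ 2.
    have -> : 8 * Q ^+ 6 = 2 ^+ 471.
      by rewrite /Q -exprM (_ : 8 = 2 ^+ 3) -?exprD //; rewrite -natrX.
    by rewrite /t -exprM ler_weXn2l ?ler1n //; clear -k236; lia.
  apply: le_trans h8 (le_trans _ P470).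
  apply: le_trans (_ : 8 * (Q ^+ 6 * t ^+ 468) <= _); first by rewrite ler_pM2l.
  by rewrite mulrA (exprD t 2 468) ler_pM2r.
have main := trip k0 n0L big large.
apply: cr_le main; rewrite -/X -/Y -/L.
have det := detour_estimate Q1 ty yt n0y Ele.
rewrite -/t in det.
have tN : t * t ^+ 360 <= y ^+ 5 by rewrite -exprS; apply: le_trans y5; exact: tle.
have tle5 : t <= y ^+ 5 by apply: le_trans y5; exact: (tle 1%N).
have tL : t * (L / lvlM k ^+ 2) <= Q * y ^+ 5.
  rewrite ME -exprM mulrA ler_pdivrMr //.
  apply: le_trans (_ : t * y ^+ 6 <= _); first by rewrite ler_pM2l.
  rewrite [y ^+ 6]exprS mulrA [Q * _ * _]mulrAC ler_pM2r //.
  apply: le_trans (ler_wpM2l (ltW t0) yt) _.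
  rewrite mulrCA -exprS ler_pM2l; [exact: tle | exact: lt_le_trans Q1].
rewrite NE -[1920 * L / _]mulrA.
exact: (error_total _ t0 y50 tL det tN tle5).
Qed.

End Trip.

Lemma exists_scale (R : realType) (d : R) (k0 : nat) : 2 ^+ (468 * k0) <= d ->
  exists k, [/\ (k0 <= k)%N, 2 ^+ (468 * k) <= d & d <= 2 ^+ (468 * k.+1)].
Proof.
move=> hd.
have [m hm] : exists m, d <= 2 ^+ (468 * m).
  have d0 : 0 <= d by apply: le_trans hd; rewrite exprn_ge0.
  exists (Num.truncn d).+1; apply: le_trans (ltW (truncnS_gt d)) _.
  rewrite -natrX ler_nat; apply: leq_trans (ltnW (ltn_expl _ (isT : (1 < 2)%N))) _.
  by rewrite leq_exp2l // leq_pmull.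
have [k hk kmin] := ex_minnP (ex_intro (fun m => d <= 2 ^+ (468 * m)) m hm).
case: (leqP k k0) => kk.
  exists k0; split=> //; apply: le_trans hk _.
  by rewrite ler_weXn2l ?ler1n // leq_mul2l /= ltnW.
case: k hk kmin kk => // k hk kmin kk; exists k; split=> //.
rewrite leNgt; apply/negP => lt.
by have := kmin k (ltW lt); rewrite ltnn.
Qed.

Lemma exists_pow2 (R : realType) (x : R) : exists k : nat, (236 <= k)%N /\ x <= 2 ^+ k.
Proof.
exists (236 + (Num.truncn `|x|).+1)%N; split; first exact: leq_addr.
apply: le_trans (ler_norm x) _; apply: le_trans (ltW (truncnS_gt `|x|)) _.
rewrite -natrX ler_nat; apply: leq_trans (ltnW (ltn_expl _ (isT : (1 < 2)%N))) _.
by rewrite leq_exp2l // leq_addl.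
Qed.

Lemma grid_pt_coarse (R : realType) (P Q z w : int * int) :
  `|P.1 - 40 * z.1| <= 40 -> `|P.2 - 40 * z.2| <= 40 ->
  `|Q.1 - 40 * w.1| <= 40 -> `|Q.2 - 40 * w.2| <= 40 ->
  60 * enorm (w.1%:~R - z.1%:~R : R) (w.2%:~R - z.2%:~R)
  <= eucl_dist (grid_pt R P) (grid_pt R Q) + 240.
Proof.
move=> P1 P2 Q1 Q2; set X : R := w.1%:~R - z.1%:~R; set Y : R := _ - z.2%:~R.
have intR (a b : int) : `|a - 40 * b| <= 40 -> `|a%:~R - 40 * b%:~R| <= 40 :> R.
  by rewrite -(ler_int R) intr_norm intrB intrM.
move: (intR _ _ P1) (intR _ _ P2) (intR _ _ Q1) (intR _ _ Q2) => {}P1 {}P2 {}Q1 {}Q2.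
have -> : 60 * enorm X Y = enorm (60 * X) (60 * Y) by rewrite enormZ ger0_norm.
set p := grid_pt R P; set q := grid_pt R Q.
have -> : 60 * X = (q.1 - p.1) + (60 * X - (q.1 - p.1)) by rewrite addrC subrK.
have -> : 60 * Y = (q.2 - p.2) + (60 * Y - (q.2 - p.2)) by rewrite addrC subrK.
apply: le_trans (enormD _ _ _ _) _.
rewrite [eucl_dist p q]eucl_distC lerD2l; apply: le_trans (enorm_le_l1 _ _) _.
have h1 : `|60 * X - (q.1 - p.1)| <= 120.
  by move: P1 Q1; rewrite /X /p /q /= !ler_norml; lra.
have h2 : `|60 * Y - (q.2 - p.2)| <= 120.
  by move: P2 Q2; rewrite /Y /p /q /= !ler_norml; lra.
by lra.
Qed.

(** Of the two terms [C * (Y / t)], one is the error of the trip and the other absorbs the bounded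
    losses. *)
Lemma error_le (R : realType) (C eta t Y : R) :
  1040 <= C -> 0 < eta -> 0 < t -> t <= Y -> 2 * C / eta <= t ->
  2 * C * (Y / t) <= eta * Y /\ 1040 <= C * (Y / t).
Proof.
move=> C_ge eta0 t0 tY t_eta; split.
  have h : 2 * C <= eta * t by rewrite [eta * t]mulrC -ler_pdivrMr.
  rewrite mulrA ler_pdivrMr //.
  by have := ler_wpM2r (le_trans (ltW t0) tY) h; lra.
have C0 : 0 <= C by lra.
apply: le_trans C_ge _; apply: ler_peMr => //.
by rewrite ler_pdivlMr ?mul1r.
Qed.

Theorem theorem4 (R : realType) :
  exists H : sgraph (R * R)%type,
    [/\ vertices H = grid R,
        forall x y : R * R, adj H x y -> eucl_dist x y = 3 / 2,
        exists K : R, forall p q : R * R, vertices H p -> vertices H q ->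
          ((eucl_dist p q - K)%:E <= gdist R H p q)%E
      & forall eta : R, 0 < eta ->
          exists D : R, forall p q : R * R, vertices H p -> vertices H q ->
            D <= eucl_dist p q ->
            (`|gdist R H p q - (eucl_dist p q)%:E|
              <= (eta * (eucl_dist p q) `^ (5 / 6))%:E)%E].
Proof.
have [act [F [F_close act_F act_near act_blocked]]] := road_drawing R.
have [C [C_ge trip]] := trip_estimate
  (fun z z' c c' h => @reach_le R _ _ (coarse z) (coarse z') c c' h)
  (fun z z' z'' c c' h h' => reach_trans h h')
  (creach_lattice F_close) (leg F_close act_F act_near act_blocked).
exists (comb_graph F_close); split.
- by [].
- exact: comb_graph_edge.
- by exists 1000; exact: comb_graph_lower.
move=> eta eta0.
have [k0 [k236 k0eta]] := exists_pow2 (2 * C / eta).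
exists (2 ^+ (468 * k0)) => p q vp vq dD.
have lower := comb_graph_lower vp vq.
set d := eucl_dist p q in dD lower *.
have [k [k0k dk dk1]] := exists_scale dD.
pose t : R := 2 ^+ k.
have t_ge1 : 1 <= t by apply: exprn_ege1; rewrite ler1n.
have t0 : 0 <= t by lra.
have t_eta : 2 * C / eta <= t.
  by apply: le_trans k0eta _; rewrite /t ler_weXn2l ?ler1n.
have d0 : 0 <= d := enorm_ge0 _ _.
pose y := d `^ 6^-1.
have y0 : 0 <= y by exact: powR_ge0.
have y6 : y ^+ 6 = d.
  by rewrite -powR_mulrn // /y -powRrM mulVf ?powRr1.
have y5 : y ^+ 5 = d `^ (5 / 6).
  by rewrite -powR_mulrn // /y -powRrM mulrC.
have ty : t ^+ 78 <= y.
  rewrite -(@ler_pXn2r _ 6%N) // ?nnegrE ?exprn_ge0 //.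
  by rewrite y6 /t -!exprM (_ : (k * 78 * 6 = 468 * k)%N) //; clear; lia.
have yt : y <= 2 ^+ 78 * t ^+ 78.
  rewrite -(@ler_pXn2r _ 6%N) // ?nnegrE ?mulr_ge0 ?exprn_ge0 //.
  rewrite y6 /t exprMn -!exprM -exprD.
  by rewrite (_ : (78 * 6 + k * 78 * 6 = 468 * k.+1)%N) //; clear; lia.
(* This gives [|X| + |Y| <= 2 * (d + 240) / 60 <= d] for the coarse displacement. *)
have d240 : 240 <= d.
  apply: le_trans dk; rewrite -natrX ler_nat.
  apply: leq_trans (ltnW (ltn_expl 240 (isT : (1 < 2)%N))) _.
  by rewrite leq_exp2l //; clear -k236 k0k; lia.
have [z [zP z1 z2]] := reach_coarse F_close (grid_index p).
have [w [wQ w1 w2]] := reach_coarse F_close (grid_index q).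
have XY := grid_pt_coarse R z1 z2 w1 w2.
have pE := (gridP p).1 vp; have qE := (gridP q).1 vq.
rewrite -pE -qE -/d in XY.
have XYd : `|w.1%:~R - z.1%:~R| + `|w.2%:~R - z.2%:~R| <= y ^+ 6 :> R.
  rewrite y6; have := l1_le_enorm (w.1%:~R - z.1%:~R : R) (w.2%:~R - z.2%:~R); lra.
have k236' : (236 <= k)%N by apply: leq_trans k0k.
have middle := trip k z w y k236' ty yt XYd.
have upper := comb_graph_upper (reach_trans zP (reach_trans middle
  (reach_sym (fine_edge_sym F_close) wQ))).
rewrite -pE -qE in upper.
have y5t : t <= y ^+ 5.
  have y1 : t <= y.
    apply: le_trans ty; rewrite -[X in X <= _]expr1; exact: ler_weXn2l.
  apply: le_trans y1 _; rewrite -[X in X <= _]expr1; apply: ler_weXn2l => //.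
  by apply: le_trans ty; exact: exprn_ege1.
have [r2 r3] := error_le C_ge eta0 (lt_le_trans ltr01 t_ge1) y5t t_eta.
(* The lower bound excludes [-oo] and the upper bound [+oo], so the graph distance is a real
   number. *)
rewrite -y5; move: lower upper; case: (gdist R _ p q) => [g| |] //.
rewrite !lee_fin => lower upper.
rewrite ler_norml.
by move: r2 r3 lower upper XY; clear; move: (y ^+ 5) (y ^+ 5 / t) => A B; lra.
Qed.
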